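(* Let $\theta\in\Theta_{pe}$, let $(U_n)_{n\ge0}$ and $(Y_n)_{n\ge -d+1}$ be the stationary processes defined in the context, and let $\mathcal G=\sigma(Z_j, j\ge1)$. Then, as $n\to\infty$, $$\frac{1}{\sqrt n}\sum_{k=1}^n U_k\to \frac{\sigma}{\sum_{i=1}^d\theta_i-1}\,(1,1,\dots,1)^T N_1\qquad \mathcal G\text{-mixing},$$ where $N_1$ is a real random variable with distribution $N(0,1)$ that is independent of $\mathcal G$. In particular, as $n\to\infty$, $$\frac{1}{\sqrt n}\sum_{k=1}^n Y_k\to \frac{\sigma}{\sum_{i=1}^d\theta_i-1}\,N_1\qquad \mathcal G\text{-mixing}.$$
   Context: All random variables are defined on a probability space $(\Omega,\mathcal F,P)$. Fix $d\in\mathbb N$, $d\ge1$, and $\theta=(\theta_1,\dots,\theta_d)^T\in\mathbb R^d$. $(Z_n)_{n\ge1}$ is an i.i.d. sequence of real random variables with $Z_1$ square-integrable, $E(Z_1)=0$ and $\sigma^2=\mathrm{Var}(Z_1)>0$ ($\sigma>0$). $B=B(\theta)\in\mathbb R^{d\times d}$ is the companion matrix whose first row is $(\theta_1,\dots,\theta_d)$ and whose $i$-th row, $2\le i\le d$, is $e_{i-1}^T$ ($e_1,\dots,e_d$ the unit vectors of $\mathbb R^d$; for $d=1$, $B=\theta_1$). $W_n=(Z_n,0,\dots,0)^T=Z_ne_1$. $\Theta_{pe}$ is the set of $\theta\in\mathbb R^d$ such that all complex eigenvalues of $B(\theta)$ have absolute value $>1$; for such $\theta$, $\theta_d\neq0$,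 $B$ is invertible, and $\sum_{i=1}^d\theta_i\ne1$. The standing assumption is $\theta\in\Theta_{pe}$. We write $B^{-j}=(B^{-1})^j$. The process $(Y_n)_{n\ge-d+1}$ satisfies $Y_n=\theta_1Y_{n-1}+\dots+\theta_dY_{n-d}+Z_n$ for $n\ge1$, and $U_n=(Y_n,Y_{n-1},\dots,Y_{n-d+1})^T$, $n\ge0$, so $U_n=BU_{n-1}+W_n$ for $n\ge1$; the initial value is $U_0=(Y_0,\dots,Y_{-d+1})^T=-\sum_{j=1}^\infty B^{-j}W_j$ (the series converges absolutely almost surely). Consequently $U_n=-\sum_{k=1}^\infty B^{-k}e_1Z_{n+k}$ almost surely for $n\ge0$. $\mathcal G$-mixing convergence: for $\mathbb R^m$-valued random vectors $X_n$ and a random vector $X$ independent of $\mathcal G$ (possibly defined on an extension of the probability space), $X_n\to X$ $\mathcal G$-mixing means $\lim_{n\to\infty}E(f\,g(X_n))=E(f)\,E(g(X))$ for every integrable $\mathcal G$-measurable real $f$ and every bounded continuous $g:\mathbb R^m\to\mathbb R$. *)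

(* Defs.v *)
From mathcomp Require Import all_boot all_order all_algebra finmap.
From mathcomp Require Import complex.
From mathcomp Require Import all_classical all_reals all_analysis.

Set Implicit Arguments.
Unset Strict Implicit.
Unset Printing Implicit Defensive.

Import Order.TTheory GRing.Theory Num.Theory.
Import numFieldNormedType.Exports.

Local Open Scope classical_set_scope.
Local Open Scope ring_scope.

Definition companion {R : pzRingType} {d : nat} (theta : 'cV[R]_d) : 'M[R]_d :=
  \matrix_(i, j) if i == 0%N :> nat then theta j 0 else (i == j.+1 :> nat)%:R.

(* Eigenvalues are taken in R[i]; there, 1 < `|z| compares two real elements. *)
Definition Theta_pe {R : realType} {d : nat} : set 'cV[R]_d :=
  [set theta | forall z : R[i],
    eigenvalue (map_mx (real_complex R) (companion theta)) z -> 1 < `|z|].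

(* z e_1 *)
Definition e1_scaled {R : pzRingType} (d : nat) (z : R) : 'cV[R]_d :=
  \col_i if i == 0%N :> nat then z else 0.

(* U_n = (Y_n, Y_(n-1), ..., Y_(n-d+1))^T *)
Definition lag_vector {T R : Type} (d : nat) (Y : int -> T -> R)
    (n : nat) (w : T) : 'cV[R]_d :=
  \col_(i < d) Y (n%:Z - i%:Z) w.

Section independence.
Context {dT : measure_display} {T : measurableType dT} {R : realType}.
Variable P : probability T R.

Definition mutually_independent {I : choiceType} (D : set I)
    (X : I -> {RV P >-> R}) : Prop :=
  forall (J : {fset I}) (A : I -> set R),
    [set` J] `<=` D -> (forall i, i \in J -> measurable (A i)) ->
    P (\bigcap_(i in [set` J]) (X i @^-1` A i)) =
      (\prod_(i <- J) P (X i @^-1` A i))%E.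

Definition identically_distributed {I : Type} (D : set I)
    (X : I -> {RV P >-> R}) : Prop :=
  forall i j, D i -> D j -> forall A : set R, measurable A ->
    distribution P (X i) A = distribution P (X j) A.

Definition iid {I : choiceType} (D : set I) (X : I -> {RV P >-> R}) : Prop :=
  mutually_independent D X /\ identically_distributed D X.

Definition independent_systems (F G : set (set T)) : Prop :=
  forall A B, F A -> G B -> P (A `&` B) = (P A * P B)%E.

Definition sigma_family {I : Type} (D : set I) (X : I -> {RV P >-> R}) :
    set (set T) :=
  <<s \bigcup_(i in D) g_sigma_algebra_preimage (X i) >>.

End independence.

(* The sigma-algebra generated by X, for the Borel sigma-algebra on V. *)
Definition borel_preimage {T : Type} {V : topologicalType} (X : T -> V) :
    set (set T) :=
  preimage_set_system setT X <<s open >>.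

Definition random_element {dT : measure_display} {T : measurableType dT}
    {V : topologicalType} (X : T -> V) : Prop :=
  borel_preimage X `<=` measurable.

Section mixing.
Context {dT dT' : measure_display}.
Context {T : measurableType dT} {T' : measurableType dT'} {R : realType}.
Variables (P : probability T R) (P' : probability T' R).

(* (T', P') extends (T, P) along the projection proj: an event A of T is
   identified with proj^-1(A). *)
Definition is_extension (proj : {RV P' >-> T}) : Prop :=
  forall A : set T, measurable A -> distribution P' proj A = P A.

(* F is independent of the sub-sigma-algebra G of T, seen on T'. *)
Definition independent_of_base (proj : {RV P' >-> T}) (G : set (set T))
    (F : set (set T')) : Prop :=
  independent_systems P' (preimage_set_system setT proj G) F.

Definition mixing_cvg (proj : {RV P' >-> T}) (G : set (set T))
    {V : topologicalType} (X_ : nat -> T -> V) (X : T' -> V) : Prop :=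
  [/\ forall n, random_element (X_ n),
      random_element X,
      independent_of_base proj G (borel_preimage X) &
      forall (f : T -> R) (g : V -> R),
        P.-integrable setT (EFin \o f) ->
        g_sigma_algebra_preimage f `<=` G ->
        continuous g -> (exists M : R, forall x, `|g x| <= M) ->
        (fun n => ('E_P[fun w => (f w * g (X_ n w))%R])%E) @ \oo -->
          ('E_P[f] * 'E_P'[g \o X])%E ].

End mixing.

(* Main.v *)
From HB Require Import structures.
Require Import Defs.
From mathcomp Require Import all_boot all_order all_algebra finmap.
From mathcomp Require Import complex.
From mathcomp Require Import all_classical all_reals all_analysis.
From mathcomp Require Import measurable_realfun.
From mathcomp Require Import ring lra zify.

(** Write [B] for the companion matrix, [s] for the sum of the [theta_i] and
    [S_n] for [Z_1 + ... + Z_n].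

    Summing the recursion over [k <= n] turns every lagged sum of [Y] into the
    unlagged one up to finitely many values of [Y] near the two ends, so
    [(1 - s) (Y_1 + ... + Y_n)] is [S_n] plus boundary terms ([lag_sumE],
    [lag_sum_rec]).  Here [s] differs from [1], since otherwise the constant
    vector would be an eigenvector of [B] for the eigenvalue [1]
    ([sum_theta_neq1]).  The boundary terms are bounded in [L^1] uniformly in
    [n] ([state_L1_bounded]): the initial value propagates through the recursion
    to [U_n = - sum_(k >= 1) B^-k e_1 Z_(n + k)], and the entries of [B^-k] are
    summable because the eigenvalues of [B^-1] lie in the open unit disc
    ([companion_inv_summable]).  Divided by [sqrt n] the boundary terms vanish in
    [L^1], so both sequences of the theorem are, up to an [L^1]-small error, fixed
    continuous images of [S_n / sqrt n].

    It remains to prove the mixing central limit theorem for [S_n / sqrt n]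
    ([mixing_clt_transfer]).  First the weight is the indicator [G] of an event
    that depends on [Z_1, ..., Z_(k - 1)] and the test function is
    [y |-> cos (t y + a)].  Adding one innovation multiplies the expectation by
    [exp (- t^2 sigma^2 / (2 n))] up to an error that is [o (1 / n)] by a second
    order Taylor expansion, so after [n] steps the total error vanishes
    ([mixing_clt_trig]); the first [k - 1] innovations are negligible, which is why
    conditioning on them does not change the limit.  The limit is
    [cos a * exp (- t^2 sigma^2 / 2)], the value that the characteristic function
    of the normal law prescribes ([normal_char]).  A bounded continuous function is
    uniformly close, on any bounded interval, to a Bernstein polynomial in the sine
    of a slow frequency, which is a combination of such trigonometric functions,
    and Chebyshev's inequality controls the complement ([weak_cvg_continuous]).  An
    [L^1]-small perturbation of the argument changes nothing ([slutsky]).  Finally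
    the weights: the events for which the limit holds form a Dynkin system, which
    contains the cylinder events, hence the whole sigma-algebra of the innovations
    ([mixes_sigma]), and staircase approximations reach every integrable weight
    ([mixes_measurable]). *)

Set Implicit Arguments.
Unset Strict Implicit.
Unset Printing Implicit Defensive.

Import Order.TTheory GRing.Theory Num.Theory.
Import numFieldNormedType.Exports.

Local Open Scope classical_set_scope.
Local Open Scope ring_scope.

(** * Integrals against a probability measure *)

(** The three-epsilon argument behind every approximation below; the comparison
    sequence may depend on the accuracy. *)
Lemma cvg_approx (R : realType) (u : nat -> R) (l : R) :
  (forall e : R, 0 < e -> exists (v : nat -> R) (l' : R),
     [/\ v @ \oo --> l', `|l - l'| <= e & \forall n \near \oo, `|u n - v n| <= e]) ->
  u @ \oo --> l.
Proof.
move=> H; apply/cvgrPdist_le => e e0.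
have e3 : 0 < e / 3 by rewrite divr_gt0.
have [v [l' [vl ll' uv]]] := H _ e3.
move/cvgrPdist_le : vl => /(_ _ e3) vl.
near=> n.
have h1 : `|l' - v n| <= e / 3 by near: n.
have h2 : `|u n - v n| <= e / 3 by near: n.
rewrite (_ : l - u n = (l - l') + (l' - v n) - (u n - v n)); last by ring.
apply: (le_trans (ler_normB _ _)); apply: (le_trans (lerD (ler_normD _ _) (lexx _))).
lra.
Unshelve. all: by end_near. Qed.

Section integration.
Context d (T : measurableType d) (R : realType) (P : probability T R).
Implicit Types f g : T -> R.

Local Notation L1 f := (P.-integrable setT (EFin \o f)).

Lemma bounded_L1 f M : measurable_fun setT f -> (forall x, `|f x| <= M) -> L1 f.
Proof.
move=> mf fM; apply: measurable_bounded_integrable => //.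
  by apply: (le_lt_trans (probability_le1 P measurableT)); exact: ltry.
by exists M; split=> [|N MN x _ /=]; [exact: num_real|exact: le_trans (fM x) (ltW MN)].
Qed.

Lemma L1_measurable f : L1 f -> measurable_fun setT f.
Proof. by move=> /measurable_int /measurable_EFinP. Qed.

Lemma dominated_L1 f g : measurable_fun setT f -> L1 g -> (forall x, `|f x| <= g x) -> L1 f.
Proof.
move=> mf ig fg; apply: le_integrable ig => //; first exact/measurable_EFinP.
by move=> x _ /=; rewrite lee_fin (le_trans (fg x))// ler_norm.
Qed.

Lemma L1_norm f : L1 f -> L1 (fun x => `|f x|).
Proof. by move=> /integrable_norm. Qed.

Lemma L1D f g : L1 f -> L1 g -> L1 (fun x => f x + g x).
Proof. by move=> ? ?; rewrite /comp; under eq_fun do rewrite EFinD; exact: integrableD. Qed.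

Lemma L1B f g : L1 f -> L1 g -> L1 (fun x => f x - g x).
Proof. by move=> ? ?; rewrite /comp; under eq_fun do rewrite EFinB; exact: integrableB. Qed.

Lemma L1Z k f : L1 f -> L1 (fun x => k * f x).
Proof. by move=> ?; rewrite /comp; under eq_fun do rewrite EFinM; exact: integrableZl. Qed.

Lemma L1_mul_bounded f g M : L1 f -> measurable_fun setT g -> (forall x, `|g x| <= M) ->
  L1 (fun x => f x * g x).
Proof.
move=> fi mg gM; apply: (@dominated_L1 _ (fun x => M * `|f x|)).
- by apply: measurable_funM => //; exact: L1_measurable.
- exact/L1Z/L1_norm.
- by move=> x; rewrite normrM mulrC ler_wpM2r.
Qed.

Lemma L1_cst (k : R) : L1 (fun=> k).
Proof. by apply: (@bounded_L1 _ `|k|) => //. Qed.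

Lemma Rint_cst (k : R) : \int[P]_x k = k.
Proof. by rewrite Rintegral_cst//= probability_setT/= mulr1. Qed.

Lemma L1_sum (I : Type) (s : seq I) (F : I -> T -> R) :
  (forall i, L1 (F i)) -> L1 (fun x => \sum_(i <- s) F i x).
Proof.
move=> iF; elim: s => [|i s IHs].
  by under eq_fun do rewrite big_nil; exact: L1_cst.
by under eq_fun do rewrite big_cons; exact: L1D.
Qed.

Lemma Rint_sum (I : Type) (s : seq I) (F : I -> T -> R) :
  (forall i, L1 (F i)) ->
  \int[P]_x (\sum_(i <- s) F i x) = \sum_(i <- s) \int[P]_x F i x.
Proof.
move=> iF; elim: s => [|i s IHs].
  by under eq_Rintegral do rewrite big_nil; rewrite big_nil Rint_cst.
under eq_Rintegral do rewrite big_cons.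
by rewrite big_cons RintegralD ?IHs//; exact: L1_sum.
Qed.

Lemma le_Rint f g : L1 f -> L1 g -> (forall x, f x <= g x) ->
  \int[P]_x f x <= \int[P]_x g x.
Proof. by move=> fi gi fg; apply: le_Rintegral. Qed.

Lemma le_Rint_norm f g : L1 f -> L1 g -> (forall x, `|f x| <= g x) ->
  `|\int[P]_x f x| <= \int[P]_x g x.
Proof.
move=> fi gi fg; apply: le_trans (le_normr_Rintegral _ _) _ => //.
by apply: le_Rint => //; exact: L1_norm.
Qed.

Lemma Rint_norm_le f M : measurable_fun setT f -> (forall x, `|f x| <= M) ->
  `|\int[P]_x f x| <= M.
Proof.
move=> mf fM; rewrite -[leRHS]Rint_cst; apply: le_Rint_norm => //.
  exact: bounded_L1 fM.
exact: L1_cst.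
Qed.

Lemma Rint_dist_le f g h : L1 f -> L1 g -> L1 h ->
  (forall x, `|f x - g x| <= h x) -> `|\int[P]_x f x - \int[P]_x g x| <= \int[P]_x h x.
Proof.
move=> fi gi hi fgh; rewrite -RintegralB//; apply: le_Rint_norm => //; exact: L1B.
Qed.

Lemma Rint_dct (f_ : nat -> T -> R) f g :
  (forall n, measurable_fun setT (f_ n)) -> (forall x, f_ ^~ x @ \oo --> f x) ->
  L1 g -> (forall n x, `|f_ n x| <= g x) ->
  (fun n => \int[P]_x f_ n x) @ \oo --> \int[P]_x f x.
Proof.
move=> mf ff gi fg; rewrite /Rintegral.
have mff : measurable_fun setT f by apply: (measurable_fun_cvg mf) => x _; exact: ff.
have [] := @dominated_convergence _ _ _ P _ measurableT (fun n => EFin \o f_ n) (EFin \o f) (EFin \o g).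
- by move=> n; exact/measurable_EFinP.
- exact/measurable_EFinP.
- by apply: aeW => x _; apply: cvg_EFin; [exact: nearW|exact: ff].
- exact: gi.
- by apply: aeW => x n _ /=; rewrite lee_fin.
move=> fi _ h; apply: fine_cvg => /=; rewrite fineK//.
exact: integrable_fin_num.
Qed.

Lemma Rint_indic A : measurable A -> \int[P]_x \1_A x = fine (P A).
Proof. by move=> mA; rewrite /Rintegral integral_indic// setIT. Qed.

Lemma expectationE f : L1 f -> ('E_P[f] = (\int[P]_x f x)%:E)%E.
Proof. by move=> fi; rewrite unlock /Rintegral fineK//; exact: integrable_fin_num. Qed.

End integration.

(** The increasing staircase with steps of height [e] approximates the identity;
    composing it with a function [psi] approximates [psi] uniformly by
    combinations of indicators of events [psi @^-1` I j].  This one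
    approximation serves wherever indicators have to be replaced by functions.
    *)
Lemma staircase_approx (R : realType) (M e : R) : 0 < e ->
  exists (N : nat) (c : R) (I : nat -> set R), (forall j, measurable (I j)) /\
    forall x, `|x| <= M -> `|x - (c + \sum_(j < N) e * \1_(I j) x)| <= e.
Proof.
move=> e0.
(* A ray indicator as a boolean, so that the staircase is a sum over the steps below [y]. *)
have indic_ray (a y : R) : \1_(`[a, +oo[%classic) y = (a <= y)%R%:R :> R.
  rewrite indicE; congr (_%:R); congr nat_of_bool.
  by apply/idP/idP; rewrite inE/= in_itv/= andbT.
have stair N y : 0 <= y <= N%:R * e ->
   0 <= y - \sum_(j < N) e * (j.+1%:R * e <= y)%R%:R <= e.
  elim: N y => [|N IHN] y.
    by rewrite mul0r big_ord0 => /andP[y0 y1]; rewrite subr0 y0 (le_trans y1)// ltW.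
  move=> /andP[y0 yN]; rewrite big_ord_recr/=.
  have [yN'|yN'] := leP y (N%:R * e).
    have -> : (N.+1%:R * e <= y) = false.
      by apply/negbTE; rewrite -ltNge (le_lt_trans yN')// ltr_pM2r// ltr_nat.
    by rewrite mulr0 addr0; apply: IHN; rewrite y0.
  have -> : \sum_(i < N) e * (i.+1%:R * e <= y)%R%:R = N%:R * e.
    rewrite (eq_bigr (fun=> e)) ?sumr_const ?card_ord ?mulr_natl// => i _.
    rewrite (_ : _ <= _ = true) ?mulr1//; apply: le_trans (ltW yN').
    by rewrite ler_wpM2r ?(ltW e0)// ler_nat ltn_ord.
  have [h|h] := leP (N.+1%:R * e) y.
    have -> : y = N.+1%:R * e by apply/eqP; rewrite eq_le yN h.
    by rewrite -natr1 mulrDl mul1r mulr1 subrr lexx ltW.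
  rewrite mulr0 addr0 subr_ge0 (ltW yN')/=.
  by move: yN; rewrite -natr1 mulrDl mul1r; lra.
exists (Num.truncn (2 * M / e)).+1, (- M), (fun j => `[- M + j.+1%:R * e, +oo[%classic).
split=> [j|x xM]; first exact: measurable_itv.
have M0 : 0 <= M by exact: le_trans xM.
have /stair : 0 <= x + M <= (Num.truncn (2 * M / e)).+1%:R * e.
  move: xM; rewrite ler_norml => /andP[xM1 xM2].
  rewrite -ler_pdivrMr//; apply/andP; split; first lra.
  apply: le_trans (ltW (Num.Theory.truncnS_gt _)).
  rewrite ler_pM2r ?invr_gt0//; lra.
under eq_bigr do rewrite -lerBlDr addrC -indic_ray.
set S := \sum_(j < _) _ => /andP[h1 h2].
by rewrite ger0_norm; lra.
Qed.

(** * Extending mixing limits from events to integrable functions *)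

Section mixing_closure.
Context d (T : measurableType d) (R : realType) (P : probability T R).
Variables (q : nat -> T -> R) (c M : R).
Hypothesis mq : forall n, measurable_fun setT (q n).
Hypothesis qM : forall n x, `|q n x| <= M.

Local Notation L1 f := (P.-integrable setT (EFin \o f)).

(** The limit that defines mixing convergence, for a single sequence [q] of test
    values; its dependence on the weight [f] is what has to be enlarged. *)
Definition mixes (f : T -> R) :=
  (fun n => \int[P]_x (f x * q n x)) @ \oo --> (\int[P]_x f x) * c.

(** The pairing of [f] with a uniformly bounded sequence is Lipschitz in [f] for
    the [L^1] norm, uniformly in [n]. *)
Lemma mixes_L1_closed f : L1 f ->
  (forall e : R, 0 < e -> exists g, [/\ L1 g, mixes g & \int[P]_x `|f x - g x| <= e]) ->
  mixes f.
Proof.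
move=> fi H; apply: cvg_approx => e e0.
have M0 : 0 <= M by exact: le_trans (qM 0%N point).
have K0 : 0 < M + `|c| + 1 by rewrite ltr_wpDl// addr_ge0.
have [g [gi gm fg]] := H (e / (M + `|c| + 1)) (divr_gt0 e0 K0).
have fgi : L1 (fun x => `|f x - g x|) by exact/L1_norm/L1B.
exists (fun n => \int[P]_x (g x * q n x)), ((\int[P]_x g x) * c); split => //.
  rewrite -mulrBl normrM -RintegralB//.
  have h : `|\int[P]_x (f x - g x)| <= e / (M + `|c| + 1).
    by apply: le_trans fg; apply: le_normr_Rintegral => //; exact: L1B.
  apply: (le_trans (ler_wpM2r (normr_ge0 _) h)).
  by rewrite mulrAC ler_pdivrMr// ler_pM2l// ; lra.
apply: nearW => n.
apply: (@le_trans _ _ (\int[P]_x (M * `|f x - g x|))).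
  apply: Rint_dist_le; [exact: L1_mul_bounded (qM n)|exact: L1_mul_bounded (qM n)|exact: L1Z|].
  by move=> x; rewrite -mulrBl normrM mulrC ler_wpM2r.
rewrite RintegralZl//; apply: (le_trans (ler_wpM2l M0 fg)).
rewrite mulrCA ger_pMr// ler_pdivrMr// mul1r.
by have := normr_ge0 c; lra.
Qed.

Lemma mixesD f g : L1 f -> L1 g -> mixes f -> mixes g -> mixes (fun x => f x + g x).
Proof.
move=> fi gi mf mg; rewrite /mixes RintegralD// mulrDl.
rewrite (_ : (fun n => _) = (fun n => \int[P]_x (f x * q n x) + \int[P]_x (g x * q n x))).
  exact: cvgD.
apply/funext => n; rewrite -RintegralD//; [|exact: L1_mul_bounded (qM n)|exact: L1_mul_bounded (qM n)].
by apply: eq_Rintegral => x _; rewrite mulrDl.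
Qed.

Lemma mixesZ k f : L1 f -> mixes f -> mixes (fun x => k * f x).
Proof.
move=> fi mf; rewrite /mixes RintegralZl// -mulrA.
rewrite (_ : (fun n => _) = (fun n => k * \int[P]_x (f x * q n x))).
  by apply: cvgM => //; exact: cvg_cst.
apply/funext => n; rewrite -RintegralZl//; last exact: L1_mul_bounded (qM n).
by apply: eq_Rintegral => x _; rewrite mulrA.
Qed.

Lemma mixes_sum (I : Type) (s : seq I) (F : I -> T -> R) :
  (forall i, L1 (F i)) -> (forall i, mixes (F i)) ->
  mixes (fun x => \sum_(i <- s) F i x).
Proof.
move=> iF mF; elim: s => [|i s IHs].
  rewrite (_ : (fun=> _) = (fun x => 0 * 0)); last first.
    by apply/funext => x; rewrite big_nil mul0r.
  apply: mixesZ; first exact: L1_cst.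
  rewrite /mixes Rint_cst mul0r.
  under eq_fun do (under eq_Rintegral do rewrite mul0r).
  by under eq_fun do rewrite Rint_cst; exact: cvg_cst.
rewrite (_ : (fun=> _) = (fun x => F i x + \sum_(i <- s) F i x)).
  by apply: mixesD => //; exact: L1_sum.
by apply/funext => x; rewrite big_cons.
Qed.

Lemma sum_indic_trivIset (F : nat -> set T) (tF : trivIset setT F) j x n :
  F j x -> \sum_(k < n) \1_(F k) x = (j < n)%N%:R :> R.
Proof.
move=> Fjx.
have E k : \1_(F k) x = (k == j)%:R :> R.
  rewrite indicE; congr (_%:R); congr nat_of_bool; apply/idP/eqP => [|->].
    by rewrite inE => Fkx; apply: (tF k j) => //; exists x.
  by rewrite inE.
under eq_bigr do rewrite E.
elim: n => [|n IHn]; first by rewrite big_ord0.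
by rewrite big_ord_recr/= IHn -natrD ltnS; congr (_%:R); case: ltngtP.
Qed.

(** The events that mix form a Dynkin system: complements by linearity, disjoint
    unions because the finite partial unions converge in [L^1]. *)
Lemma mixes_sigma (C : set (set T)) :
  setI_closed C -> C `<=` measurable -> mixes (\1_setT) ->
  (forall B, C B -> mixes \1_B) -> forall B, <<s C >> B -> mixes \1_B.
Proof.
move=> CI Cm mT mC B CB.
have ii A : measurable A -> L1 (\1_A : T -> R) by exact: integrable_indic.
pose H := [set A : set T | measurable A /\ mixes (\1_A : T -> R)].
suff HB : H B by case: HB.
apply: (@lambda_system_subset _ C CI setT H _ _ _ B CB) => //; last first.
  by move=> A CA; split; [exact: Cm|exact: mC].
apply/dynkin_lambda_system; split.
- by split.
- move=> A [mA xA]; split; first exact: measurableC.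
  rewrite (_ : \1_(~` A) = (fun x => \1_setT x + (-1) * \1_A x)).
    by apply: mixesD; [exact: ii|exact/L1Z/ii|exact: mT|apply: mixesZ => //; exact: ii].
  by apply/funext => x; rewrite !indicE in_setC in_setT; case: (x \in A) => /=; ring.
- move=> F tF mF.
  have mF1 n : measurable (F n) by have [] := mF n.
  have mU : measurable (\bigcup_k F k) by exact: bigcup_measurable.
  split => //; apply: mixes_L1_closed => [|e e0]; first exact: ii.
  pose g n x : R := \sum_(k < n) \1_(F k) x.
  have gi n : L1 (g n) by apply: L1_sum => k; exact: ii.
  have Fg x : (exists2 j, F j x & forall n, g n x = (j < n)%N%:R) \/
      (~ (\bigcup_k F k) x /\ forall n, g n x = 0).
    have [[j _ Fjx]|nF] := pselect ((\bigcup_k F k) x); [left|right].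
      by exists j => // n; exact: sum_indic_trivIset.
    split=> // n; apply: big1 => k _; rewrite indicE memNset// => Fkx.
    by apply: nF; exists k.
  have : (fun n => \int[P]_x `|\1_(\bigcup_k F k) x - g n x|) @ \oo --> (0 : R).
    rewrite -[X in _ --> X](Rint_cst P).
    apply: (@Rint_dct _ _ _ _ _ _ (fun=> 1)).
    - move=> n; apply: measurableT_comp => //.
      by apply: measurable_funB; [exact: measurable_indic|exact: L1_measurable (gi n)].
    - move=> x; have [[j Fjx gE]|[nF gE]] := Fg x.
        apply: cvg_near_cst; exists j.+1 => // n /= jn.
        by rewrite gE jn indicE mem_set ?subrr ?normr0//; exists j.
      apply: cvg_near_cst; apply: nearW => n.
      by rewrite gE indicE memNset// subr0 normr0.
    - exact: L1_cst.
    - move=> n x; rewrite normr_id; have [[j Fjx ->]|[nF ->]] := Fg x.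
        rewrite indicE mem_set ?mulr1n; last by exists j.
        by case: ltnP => _; rewrite ?subrr ?subr0 ?normr0 ?normr1.
      by rewrite indicE memNset// subr0 normr0.
  move=> /cvgrPdist_le/(_ _ e0)[N _ /(_ N (leqnn N))]; rewrite sub0r normrN ger0_norm.
    move=> h; exists (g N); split=> //; apply: mixes_sum => k; first exact: ii.
    by have [] := mF k.
  by apply: Rintegral_ge0 => x _.
Qed.

(** Truncation is close in [L^1], and the truncated weight is uniformly close to
    a staircase, which is a combination of indicators of events of [G]. *)
Lemma mixes_measurable (G : set (set T)) f : (forall B, G B -> mixes \1_B) ->
  G `<=` measurable -> mixes \1_setT ->
  L1 f -> g_sigma_algebra_preimage f `<=` G -> mixes f.
Proof.
move=> mG Gm mT fi fG; apply: mixes_L1_closed => // e e0.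
(* Truncation at level [K] of the values of the weight. *)
pose phi (K : nat) (y : R) : R := Num.min K%:R (Num.max (- K%:R) y).
have mphi K : measurable_fun setT (phi K).
  by apply: measurable_minr => //; apply: measurable_maxr.
have phiK K y : `|phi K y| <= K%:R.
  have K0 : 0 <= K%:R :> R by [].
  rewrite ler_norml /phi; apply/andP; split; last by rewrite ge_min lexx.
  by rewrite le_min le_max lexx/= andbT (le_trans _ K0)// oppr_le0.
have phi_id K y : `|y| <= K%:R -> phi K y = y.
  by rewrite ler_norml => /andP[h1 h2]; rewrite /phi max_r// min_r.
have phi_dom K y : `|y - phi K y| <= `|y|.
  rewrite /phi; have K0 : 0 <= K%:R :> R by [].
  have [y0|y0] := leP 0 y.
    rewrite max_r; last by lra.
    by case: (leP K%:R y) => h; rewrite ?subrr ?normr0 ?normr_ge0// !ger0_norm; lra.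
  rewrite min_r; last by rewrite ge_max; lra.
  by case: (leP (- K%:R) y) => h; rewrite ?subrr ?normr0 ?normr_ge0// opprK !ler0_norm; lra.
have mf := L1_measurable fi.
have e2 : 0 < e / 2 by rewrite divr_gt0.
have [K hK] : exists K, \int[P]_x `|f x - phi K (f x)| <= e / 2.
  have : (fun K => \int[P]_x `|f x - phi K (f x)|) @ \oo --> (0 : R).
    rewrite -[X in _ --> X](Rint_cst P).
    apply: (@Rint_dct _ _ _ _ _ _ (fun x => `|f x|)).
    - move=> n; apply: measurableT_comp => //; apply: measurable_funB => //.
      exact: measurableT_comp.
    - move=> x; apply: cvg_near_cst; exists (Num.truncn `|f x|).+1 => // n /= hn.
      rewrite phi_id ?subrr ?normr0//; apply: (le_trans (ltW (Num.Theory.truncnS_gt _))).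
      by rewrite ler_nat.
    - exact: L1_norm.
    - by move=> n x; rewrite normr_id.
  move=> /cvgrPdist_le/(_ _ e2)[N _ /(_ N (leqnn N))]; rewrite sub0r normrN ger0_norm.
    by exists N.
  by apply: Rintegral_ge0 => x _.
have [N [a [I [mI aE]]]] := staircase_approx K%:R e2.
pose B j := f @^-1` (phi K @^-1` I j).
have GB j : G (B j).
  apply: fG; exists (phi K @^-1` I j); last by rewrite setTI.
  by rewrite -[X in measurable X]setTI; exact: mphi.
have ii j : L1 (\1_(B j) : T -> R) by apply: integrable_indic => //; exact: Gm.
pose g x : R := a * \1_setT x + \sum_(j < N) e / 2 * \1_(B j) x.
have iT : L1 (\1_setT : T -> R) by exact: integrable_indic.
have gi : L1 g.
  by apply: L1D; [exact: L1Z|apply: L1_sum => j; exact: L1Z].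
have fphi : L1 (fun x => `|f x - phi K (f x)|).
  apply/L1_norm/L1B => //; apply: bounded_L1 (fun x => phiK K (f x)).
  exact: measurableT_comp.
exists g; split => //.
  apply: mixesD; [exact: L1Z|by apply: L1_sum => j; exact: L1Z|exact: mixesZ|].
  by apply: mixes_sum => j; [exact: L1Z|apply: mixesZ => //; exact: mG].
have -> : e = e / 2 + \int[P]_x (e / 2) by rewrite Rint_cst; field.
apply: (@le_trans _ _ (\int[P]_x (`|f x - phi K (f x)| + e / 2))).
  apply: le_Rint => [||x]; [exact/L1_norm/L1B|by apply: L1D => //; exact: L1_cst|].
  rewrite (_ : f x - g x = (f x - phi K (f x)) + (phi K (f x) - g x)); last by ring.
  apply: (le_trans (ler_normD _ _)); rewrite lerD2l.
  apply: le_trans (aE _ (phiK K (f x))).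
  by rewrite /g indicT mulr1.
by rewrite RintegralD ?lerD2r//; exact: L1_cst.
Qed.

End mixing_closure.

(** * Taylor estimates for sine, cosine and the exponential *)

Section real_estimates.
Variable R : realType.
Implicit Types x y : R.

Lemma abs_le_1sq (y : R) : `|y| <= 1 + y ^+ 2.
Proof.
rewrite -(real_normK (num_real y)); move: `|y| => u.
have := sqr_ge0 (u - 1); have := sqr_ge0 u; have := sqr_ge0 (u + 1).
by rewrite !expr2; lra.
Qed.

(** Repeated integration of [cos <= 1] from [0] with this lemma gives the Taylor
    bounds below. *)
Lemma ge0_of_derive (f df : R -> R) : (forall x, is_derive x 1 f (df x)) -> f 0 = 0 ->
  (forall x, 0 <= x -> 0 <= df x) -> forall y, 0 <= y -> 0 <= f y.
Proof.
move=> dfE f0 df0 y y0.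
have [c + E] : exists2 c, c \in `[0, y] & f y - f 0 = df c * (y - 0).
  apply: MVT_segment => //; apply: derivable_within_continuous => x _.
  exact: ex_derive.
rewrite in_itv/= => /andP[c0 _].
by move: E; rewrite f0 !subr0 => ->; rewrite mulr_ge0// df0.
Qed.

Lemma sin_le_id y : 0 <= y -> 0 <= y - sin y.
Proof.
have dE x : is_derive x 1 (fun y => y - sin y) ((fun x => 1 - cos x) x).
  by apply: is_deriveB.
apply: (ge0_of_derive dE) => [|x _].
- by rewrite sin0 subr0.
- by rewrite subr_ge0 cos_le1.
Qed.

Lemma cos_ge_quadratic y : 0 <= cos y - 1 + y ^+ 2 / 2.
Proof.
wlog y0 : y / 0 <= y.
  by move=> H; have [/H//|/ltW y0] := leP 0 y; have := H (- y); rewrite cosN sqrrN oppr_ge0; exact.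
have dE x : is_derive x 1 (fun y => cos y - 1 + y ^+ 2 / 2) ((fun x => x - sin x) x).
  by apply: is_derive_eq; rewrite /GRing.scale /=; field.
move: y y0; apply: (ge0_of_derive dE) => [|x].
- by rewrite cos0; field.
- exact: sin_le_id.
Qed.

Lemma sin_ge_cubic y : 0 <= y -> 0 <= sin y - y + y ^+ 3 / 6.
Proof.
have dE x : is_derive x 1 (fun y => sin y - y + y ^+ 3 / 6) ((fun x => cos x - 1 + x ^+ 2 / 2) x).
  by apply: is_derive_eq; rewrite /GRing.scale /=; field.
apply: (ge0_of_derive dE) => [|x _].
- by rewrite sin0; field.
- exact: cos_ge_quadratic.
Qed.

Lemma cos_le_quartic y : 0 <= 1 - y ^+ 2 / 2 + y ^+ 4 / 24 - cos y.
Proof.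
wlog y0 : y / 0 <= y.
  move=> H; have [/H//|/ltW y0] := leP 0 y; have := H (- y).
  rewrite cosN sqrrN (_ : (- y) ^+ 4 = y ^+ 4); last by ring.
  by rewrite oppr_ge0; apply.
have dE x : is_derive x 1 (fun y => 1 - y ^+ 2 / 2 + y ^+ 4 / 24 - cos y) ((fun x => sin x - x + x ^+ 3 / 6) x).
  by apply: is_derive_eq; rewrite /GRing.scale /=; field.
move: y y0; apply: (ge0_of_derive dE) => [|x].
- by rewrite cos0; field.
- exact: sin_ge_cubic.
Qed.

(** The quadratic bound provides the integrable majorant, the cubic one the
    pointwise convergence, in the dominated convergence argument of
    [remainder_negligible]. *)
Definition small_remainder (h : R -> R) :=
  [/\ measurable_fun setT h, forall y, `|h y| <= y ^+ 2 & forall y, `|h y| <= `|y| ^+ 3].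

Lemma cos_remainder : small_remainder (fun y => cos y - 1 + y ^+ 2 / 2).
Proof.
have cosr y : `|cos y - 1 + y ^+ 2 / 2| <= y ^+ 2 / 2.
  rewrite ger0_norm ?cos_ge_quadratic//.
  by have := cos_le1 y; lra.
split.
- apply: measurable_funD.
    by apply: measurable_funB => //; apply: continuous_measurable_fun; exact: continuous_cos.
  by apply: measurable_funM => //; exact: measurable_funX.
- by move=> y; apply: (le_trans (cosr y)); have := sqr_ge0 y; lra.
- move=> y; have [y1|y1] := leP 1 `|y|.
    apply: (le_trans (cosr y)); rewrite -(real_normK (num_real y)).
    have := ler_peMl (sqr_ge0 `|y|) y1; rewrite -exprS.
    by have := sqr_ge0 `|y|; lra.
  rewrite ger0_norm ?cos_ge_quadratic//.
  have := cos_le_quartic y.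
  rewrite (_ : y ^+ 4 = `|y| ^+ 4); last first.
    by rewrite -[4%N]/(2 * 2)%N !exprM (real_normK (num_real y)).
  have y3 := exprn_ge0 3 (normr_ge0 y).
  by have := ler_piMl y3 (ltW y1); rewrite -exprS; lra.
Qed.

Lemma sin_remainder : small_remainder (fun y => sin y - y).
Proof.
have sin_cubic y : `|sin y - y| <= `|y| ^+ 3 / 6.
  wlog y0 : y / 0 <= y.
    move=> H; have [/H//|/ltW y0] := leP 0 y; have := H (- y).
    by rewrite sinN -opprD !normrN oppr_ge0; apply.
  rewrite ler0_norm; last by have := sin_le_id y0; lra.
  by rewrite (ger0_norm y0); have := sin_ge_cubic y0; lra.
split.
- by apply: measurable_funB => //; apply: continuous_measurable_fun; exact: continuous_sin.
- move=> y; rewrite -(real_normK (num_real y)); have [y1|y1] := leP `|y| 1.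
    apply: (le_trans (sin_cubic y)); have := ler_piMl (sqr_ge0 `|y|) y1; rewrite -exprS.
    by have := sqr_ge0 `|y|; lra.
  have : `|sin y - y| <= 1 + `|y| by apply: (le_trans (ler_normB _ _)); rewrite lerD2r sin_max.
  have [y2|y2] := leP 2 `|y|.
    move=> h; apply: (le_trans h).
    by have := ler_wpM2r (normr_ge0 y) y2; rewrite -expr2; lra.
  move=> _; apply: (le_trans (sin_cubic y)).
  have := ler_wpM2r (sqr_ge0 `|y|) (ltW y2); rewrite -exprS.
  by have := sqr_ge0 `|y|; lra.
- by move=> y; apply: (le_trans (sin_cubic y)); have := exprn_ge0 3 (normr_ge0 y); lra.
Qed.

Lemma cos_lipschitz x y : `|cos (x + y) - cos x| <= 2 * `|y|.
Proof.
have sy : `|sin y| <= `|y|.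
  wlog y0 : y / 0 <= y.
    by move=> H; have [/H//|/ltW y0] := leP 0 y; have := H (- y); rewrite sinN !normrN oppr_ge0; apply.
  rewrite (ger0_norm y0) ler_norml; apply/andP; split; last by have := sin_le_id y0; lra.
  have [y1|y1] := leP 1 y; first by have := sin_geN1 y; lra.
  have := ler_piMl (sqr_ge0 y) (ltW y1); rewrite -exprS.
  have := ler_piMl y0 (ltW y1); rewrite -expr2.
  by have := sin_ge_cubic y0; lra.
have cy : `|cos y - 1| <= `|y|.
  rewrite ler0_norm ?subr_le0 ?cos_le1//.
  have := cos_ge_quadratic y; rewrite -(real_normK (num_real y)).
  have := cos_geN1 y; have := normr_ge0 y; have [y2|y2] := leP 2 `|y|; first by lra.
  by have := ler_wpM2r (normr_ge0 y) (ltW y2); rewrite -expr2; lra.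
rewrite cosD (_ : _ - _ = cos x * (cos y - 1) - sin x * sin y); last by ring.
apply: (le_trans (ler_normB _ _)); rewrite !normrM mulrDl !mul1r lerD//.
  by rewrite -[leRHS]mul1r ler_pM// cos_max.
by rewrite -[leRHS]mul1r ler_pM// sin_max.
Qed.

Lemma expRN_remainder y : 0 <= y -> `|expR (- y) - 1 + y| <= y ^+ 2.
Proof.
move=> y0; have h1 := expR_ge1Dx (- y).
rewrite ger0_norm; last by lra.
have h2 := expR_ge1Dx y.
have h3 : expR (- y) * expR y = 1 by rewrite -expRD addNr expR0.
have h4 : 0 < expR (- y) by exact: expR_gt0.
have h5 : expR (- y) * (1 + y) <= 1 by rewrite -[leRHS]h3 ler_pM2l.
rewrite -(ler_pM2r (x := 1 + y)); last by lra.
have := exprn_ge0 3 y0.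
rewrite (_ : (_ + y) * _ = expR (- y) * (1 + y) - 1 + y ^+ 2); last by ring.
by rewrite (_ : y ^+ 2 * _ = y ^+ 2 + y ^+ 3); [lra|ring].
Qed.

Lemma cvg_invsqrt : (fun n => (Num.sqrt n%:R)^-1 : R) @ \oo --> (0 : R).
Proof.
apply/cvgrPdist_le => e e0.
exists (Num.truncn (e ^- 2)).+1 => // n /= hn.
have n0 : 0 < n%:R :> R by rewrite ltr0n; exact: leq_trans hn.
rewrite sub0r normrN ger0_norm ?invr_ge0 ?sqrtr_ge0//.
rewrite -[leRHS]invrK lef_pV2 ?posrE ?invr_gt0 ?sqrtr_gt0//.
rewrite -(ler_pXn2r (n := 2)) ?nnegrE ?invr_ge0 ?(ltW e0) ?sqrtr_ge0//.
rewrite sqr_sqrtr ?(ltW n0)// exprVn; apply: (le_trans (ltW (Num.Theory.truncnS_gt _))).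
by rewrite ler_nat.
Qed.

Lemma cvg_invn : (fun n => n%:R^-1 : R) @ \oo --> (0 : R).
Proof.
rewrite (_ : (fun n => _) = (fun n => (Num.sqrt n%:R)^-1 * (Num.sqrt n%:R)^-1)).
  by rewrite -[X in _ --> X](mulr0 0); apply: cvgM; exact: cvg_invsqrt.
by apply/funext => n; rewrite -invfM -expr2 sqr_sqrtr.
Qed.

End real_estimates.

(** * Mutual independence for bounded functions *)

Section independence_of_bounded_functions.
Context d (T : measurableType d) (R : realType) (P : probability T R).
Variable Z : nat -> {RV P >-> R}.

Local Notation L1 f := (P.-integrable setT (EFin \o f)).

(** [G] is independent of the innovations [Z_k, Z_(k + 1), ...], expressed by
    the product rule on their rectangles.  Quantifying over all rectangles at
    once is what makes the property stable under multiplication of [G] by a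
    function of [Z_k], at the cost of raising [k]. *)
Definition indep_from (k : nat) (G : T -> R) :=
  forall (m : nat) (A : nat -> set R), (forall j, measurable (A j)) ->
    \int[P]_x (G x * \prod_(k <= j < m) \1_(A j) (Z j x)) =
    (\int[P]_x G x) * \prod_(k <= j < m) \int[P]_x \1_(A j) (Z j x).

Lemma measurable_indic_comp (X : {RV P >-> R}) (A : set R) : measurable A ->
  measurable_fun setT (fun x => \1_A (X x) : R).
Proof. by move=> mA; apply: measurableT_comp => //; exact: measurable_indic. Qed.

Lemma indic_norm_le1 (U : Type) (A : set U) (y : U) : `|\1_A y : R| <= 1.
Proof. by rewrite indicE; case: (y \in A); rewrite ?normr1 ?normr0. Qed.

Lemma prod_indic_bounded (s : seq nat) (A : nat -> set R) x :
  `|\prod_(j <- s) \1_(A j) (Z j x)| <= 1 :> R.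
Proof.
elim: s => [|j s IHs]; first by rewrite big_nil normr1.
by rewrite big_cons normrM mulr_ile1 ?normr_ge0 ?indic_norm_le1.
Qed.

Lemma prod_indic_measurable (s : seq nat) (A : nat -> set R) :
  (forall j, measurable (A j)) ->
  measurable_fun setT (fun x => \prod_(j <- s) \1_(A j) (Z j x) : R).
Proof.
move=> mA; elim: s => [|j s IHs]; first by under eq_fun do rewrite big_nil; exact: measurable_cst.
by under eq_fun do rewrite big_cons; apply: measurable_funM => //; exact: measurable_indic_comp.
Qed.

(** Both sides are linear and continuous in [psi] for uniform convergence, so
    indicators suffice, by the staircase approximation. *)
Lemma product_rule_ext (H : T -> R) (c MH : R) (X : {RV P >-> R}) :
  measurable_fun setT H -> (forall x, `|H x| <= MH) ->
  (forall A : set R, measurable A ->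
    \int[P]_x (H x * \1_A (X x)) = c * \int[P]_x \1_A (X x)) ->
  forall (psi : R -> R) (M : R), measurable_fun setT psi -> (forall y, `|psi y| <= M) ->
    \int[P]_x (H x * psi (X x)) = c * \int[P]_x psi (X x).
Proof.
move=> mH HM HA psi M mpsi psiM.
have Hi : L1 H by exact: bounded_L1 HM.
have M0 : 0 <= MH by exact: le_trans (HM point).
have mpX : measurable_fun setT (fun x => psi (X x)) by exact: measurableT_comp.
have ipX : L1 (fun x => psi (X x)) by apply: bounded_L1 (fun x => psiM (X x)).
apply/eqP; rewrite -subr_eq0 -normr_le0; apply/ler_addgt0Pr => e e0; rewrite add0r.
have K0 : 0 < MH + `|c| + 1 by rewrite ltr_wpDl// addr_ge0.
have e1 : 0 < e / (MH + `|c| + 1) by rewrite divr_gt0.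
set e' := e / _ in e1.
have [N [a [I [mI aE]]]] := staircase_approx M e1.
pose B j := psi @^-1` I j.
have mB j : measurable (B j) by rewrite -[B j]setTI; exact: mpsi.
pose S x : R := a * \1_setT (X x) + \sum_(j < N) e' * \1_(B j) (X x).
have i1 A : measurable A -> L1 (fun x => \1_A (X x) : R).
  by move=> mA; apply: (@bounded_L1 _ _ _ _ _ 1) => [|x];
    [exact: measurable_indic_comp|exact: indic_norm_le1].
have iH A : measurable A -> L1 (fun x => H x * \1_A (X x)).
  by move=> mA; apply: (L1_mul_bounded Hi (M := 1)) => [|x];
    [exact: measurable_indic_comp|exact: indic_norm_le1].
have Si : L1 S.
  by apply: L1D; [exact/L1Z/i1|apply: L1_sum => j; exact/L1Z/i1].
have SE x : `|psi (X x) - S x| <= e'.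
  by apply: le_trans (aE _ (psiM (X x))); rewrite /S indicT mulr1.
have HSE : \int[P]_x (H x * S x) = c * \int[P]_x S x.
  rewrite RintegralD//; [|exact/L1Z/i1|by apply: L1_sum => j; exact/L1Z/i1].
  rewrite RintegralZl//; last exact: i1.
  rewrite Rint_sum; last by move=> j; exact/L1Z/i1.
  under eq_Rintegral do rewrite mulrDr mulrCA mulr_sumr.
  rewrite RintegralD//; [|exact/L1Z/iH|]; last first.
    by apply: L1_sum => j; under eq_fun do rewrite mulrCA; exact/L1Z/iH.
  rewrite RintegralZl//; last exact: iH.
  rewrite HA// mulrDr mulrCA; congr (_ + _).
  rewrite Rint_sum; last by move=> j; under eq_fun do rewrite mulrCA; exact/L1Z/iH.
  rewrite mulr_sumr; apply: eq_bigr => j _.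
  under eq_Rintegral do rewrite mulrCA.
  by rewrite !RintegralZl ?HA//; [ring|exact: i1|exact: iH].
have HSi : L1 (fun x => H x * S x).
  by under eq_fun do rewrite mulrC; apply: L1_mul_bounded HM.
have e'i := L1_cst P e'.
have h1 : `|\int[P]_x (H x * psi (X x)) - \int[P]_x (H x * S x)| <= MH * e'.
  rewrite -[leRHS](Rint_cst P); apply: Rint_dist_le => //.
  - exact: L1_mul_bounded (fun x => psiM (X x)).
  - exact: L1_cst.
  - by move=> x; rewrite -mulrBr normrM ler_pM.
have h2 : `|\int[P]_x psi (X x) - \int[P]_x S x| <= e'.
  by rewrite -[leRHS](Rint_cst P); apply: Rint_dist_le.
rewrite (_ : _ - _ = (\int[P]_x (H x * psi (X x)) - \int[P]_x (H x * S x)) -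
   c * (\int[P]_x psi (X x) - \int[P]_x S x)); last by rewrite HSE; ring.
apply: (le_trans (ler_normB _ _)); rewrite normrM.
apply: (@le_trans _ _ (MH * e' + `|c| * e')); first by rewrite lerD// ler_wpM2l.
rewrite -mulrDl /e' mulrCA ger_pMr// ler_pdivrMr// mul1r lerDl ler01//.
Qed.

(** For a fixed rectangle in [Z_(k + 1), ...], the product of [G] with the
    indicator of that rectangle still satisfies the product rule with [Z_k]. *)
Lemma indep_from_mul k (G : T -> R) (M : R) (psi : R -> R) (K : R) :
  measurable_fun setT G -> (forall x, `|G x| <= M) -> indep_from k G ->
  measurable_fun setT psi -> (forall y, `|psi y| <= K) ->
  indep_from k.+1 (fun x => G x * psi (Z k x)) /\
  \int[P]_x (G x * psi (Z k x)) = (\int[P]_x G x) * \int[P]_x psi (Z k x).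
Proof.
move=> mG GM iG mpsi psiK.
have key m A : (forall j, measurable (A j)) ->
    \int[P]_x (G x * psi (Z k x) * \prod_(k.+1 <= j < m) \1_(A j) (Z j x)) =
    (\int[P]_x G x * \prod_(k.+1 <= j < m) \int[P]_x \1_(A j) (Z j x)) * \int[P]_x psi (Z k x).
  move=> mA; under eq_Rintegral do rewrite mulrAC.
  apply: (product_rule_ext (MH := M) _ _ _ mpsi psiK).
  - by apply: measurable_funM => //; exact: prod_indic_measurable.
  - move=> x; rewrite normrM -[leRHS]mulr1 ler_pM//; exact: prod_indic_bounded.
  (* The event [B] for [Z_k] is inserted in front of the rectangle [A]; when [m <= k + 1] that rectangle is empty. *)
  - move=> B mB; pose m' := maxn m k.+1; pose A' j := if j == k then B else if (j < m)%N then A j else setT.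
    have mA' j : measurable (A' j) by rewrite /A'; case: ifP => // _; case: ifP.
    have := iG m' A' mA'; have km' : (k < m')%N by rewrite leq_max leqnn orbT.
    have prodE (f : nat -> set R -> R) : (forall j, f j setT = 1) ->
        \prod_(k <= j < m') f j (A' j) = f k B * \prod_(k.+1 <= j < m) f j (A j).
      move=> fT; rewrite big_ltn// {1}/A' eqxx; congr (_ * _).
      have [mk|mk] := leqP m k.+1.
        by rewrite /m' (maxn_idPr mk) !big_geq.
      rewrite /m' (maxn_idPl (ltnW mk)); apply: eq_big_nat => j /andP[h1 h2].
      by rewrite /A' h2 gtn_eqF.
    rewrite (prodE (fun j C => \int[P]_x \1_C (Z j x))); last first.
      move=> j; under eq_Rintegral do rewrite indicT.
      by rewrite Rint_cst.
    rewrite [X in _ = _ * X]mulrC mulrA => <-; apply: eq_Rintegral => x _.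
    by rewrite (prodE (fun j C => \1_C (Z j x))) => [|j]; [ring|rewrite indicT].
have GE : \int[P]_x (G x * psi (Z k x)) = (\int[P]_x G x) * \int[P]_x psi (Z k x).
  have := key 0%N (fun=> setT) (fun=> measurableT).
  rewrite big_geq// mulr1 => <-; apply: eq_Rintegral => x _.
  by rewrite big_geq// mulr1.
by split=> // m A mA; rewrite key// GE; ring.
Qed.

Lemma indep_fromS k (G : T -> R) (M : R) : measurable_fun setT G -> (forall x, `|G x| <= M) ->
  indep_from k G -> indep_from k.+1 G.
Proof.
move=> mG GM iG; have [] := indep_from_mul mG GM iG (psi := fun=> 1) (K := 1).
- exact: measurable_cst.
- by move=> y; rewrite normr1.
- by rewrite (_ : (fun x => G x * 1) = G)//; apply/funext => x; rewrite mulr1.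
Qed.

Lemma indep_from_le k l (G : T -> R) (M : R) : measurable_fun setT G -> (forall x, `|G x| <= M) ->
  (k <= l)%N -> indep_from k G -> indep_from l G.
Proof.
move=> mG GM /subnKC <- iG; elim: (l - k)%N => [|n IHn]; first by rewrite addn0.
by rewrite addnS; exact: indep_fromS IHn.
Qed.

Lemma indep_fromB k (F G : T -> R) (M : R) :
  measurable_fun setT F -> (forall x, `|F x| <= M) ->
  measurable_fun setT G -> (forall x, `|G x| <= M) ->
  indep_from k F -> indep_from k G -> indep_from k (fun x => F x - G x).
Proof.
move=> mF FM mG GM iF iG m A mA.
have Fi : L1 F by exact: bounded_L1 FM.
have Gi : L1 G by exact: bounded_L1 GM.
under eq_Rintegral do rewrite mulrBl.
have ib (H : T -> R) : L1 H -> L1 (fun x => H x * \prod_(k <= j < m) \1_(A j) (Z j x)).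
  move=> Hi; apply: (L1_mul_bounded Hi (M := 1)); first exact: prod_indic_measurable.
  exact: prod_indic_bounded.
by rewrite !RintegralB ?iF ?iG ?mulrBl//; exact: ib.
Qed.

Definition cylinder (m : nat) (A : nat -> set R) : set T :=
  \bigcap_(i in [set j | (0 < j < m)%N]) (Z i @^-1` A i).

Lemma prod_indic_cylinder (m : nat) (A : nat -> set R) x :
  \prod_(1 <= j < m) \1_(A j) (Z j x) =
  \1_(cylinder m A) x :> R.
Proof.
rewrite [RHS]indicE; have [h|h] := boolP (x \in _).
  apply: big1_seq => j; rewrite mem_index_iota => /andP[_ jm].
  by rewrite indicE mem_set//; move: h; rewrite inE => /(_ j jm).
have [j jm nA] : exists2 j, (0 < j < m)%N & ~ A j (Z j x).
  apply: contrapT => H; move/negP: h; apply; rewrite inE => j /= jm.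
  by apply: contrapT => nA; apply: H; exists j.
apply/eqP; rewrite prodf_seq_eq0; apply/hasP; exists j; first by rewrite mem_index_iota.
by rewrite /= indicE memNset.
Qed.

Lemma cylinder_measurable (m : nat) (A : nat -> set R) : (forall j, measurable (A j)) ->
  measurable (cylinder m A).
Proof.
move=> mA; apply: bigcap_measurableType => k _.
by rewrite -[X in measurable X]setTI; exact: measurable_funPT.
Qed.

Hypothesis Zind : mutually_independent [set j | (0 < j)%N] Z.

Lemma indep_from1 : indep_from 1 (fun=> 1).
Proof.
move=> m A mA; rewrite Rint_cst mul1r.
under eq_Rintegral do rewrite mul1r prod_indic_cylinder.
rewrite Rint_indic; last exact: cylinder_measurable.
(* The finite index set on which mutual independence is used. *)
pose J : {fset nat} := [fset j in index_iota 1 m]%fset.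
have JE : [set` J] = [set j | (0 < j < m)%N].
  by apply/seteqP; split => j /=; rewrite !inE mem_index_iota.
rewrite /cylinder -JE Zind//; last by move=> j /=; rewrite !inE mem_index_iota => /andP[].
have PE j : P (Z j @^-1` A j) = (\int[P]_x \1_(A j) (Z j x))%:E.
  have mZA : measurable (Z j @^-1` A j).
    by rewrite -[X in measurable X]setTI; exact: measurable_funPT.
  rewrite (_ : (fun x => _) = \1_(Z j @^-1` A j)) // Rint_indic// fineK//.
  exact: fin_num_measure.
rewrite (eq_bigr _ (fun j _ => PE j)).
rewrite prodEFin /=; apply: perm_big; apply: uniq_perm.
- exact: fset_uniq.
- exact: iota_uniq.
- by move=> j; rewrite !inE.
Qed.

End independence_of_bounded_functions.

(** * Second moments of sums of innovations *)

Section innovations.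
Context d (T : measurableType d) (R : realType) (P : probability T R).
Variables (Z : nat -> {RV P >-> R}) (sigma : R).
Hypothesis Ziid : iid [set j | (0 < j)%N] Z.

Local Notation L1 f := (P.-integrable setT (EFin \o f)).

Hypothesis Zsq : L1 (fun x => Z 1%N x ^+ 2).
Hypothesis Zmean : \int[P]_x Z 1%N x = 0.
Hypothesis Zvar : \int[P]_x (Z 1%N x ^+ 2) = sigma ^+ 2.

Lemma identically_distributed_L1 (psi : R -> R) j : (0 < j)%N -> measurable_fun setT psi ->
  L1 (fun x => psi (Z 1%N x)) ->
  L1 (fun x => psi (Z j x)) /\ \int[P]_x psi (Z j x) = \int[P]_x psi (Z 1%N x).
Proof.
move=> j0 mpsi i1.
have E (h : R -> \bar R) : (\int[distribution P (Z j)]_y h y = \int[distribution P (Z 1%N)]_y h y)%E.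
  by apply: eq_measure_integral => A mA _; exact: Ziid.2.
have ij : L1 (fun x => psi (Z j x)).
  apply/integrableP; split; first by apply/measurable_EFinP; exact: measurableT_comp.
  have mabs : measurable_fun [set: R] (fun y => `|(psi y)%:E|%E).
    by apply: measurableT_comp => //; exact/measurable_EFinP.
  have := @ge0_integral_distribution _ _ _ _ _ P (Z j) _ mabs (fun=> abse_ge0 _).
  rewrite E => <-; rewrite ge0_integral_distribution//.
  by move/integrableP : i1 => [].
split => //; rewrite /Rintegral; congr fine.
have mE : measurable_fun [set: R] (EFin \o psi) by exact/measurable_EFinP.
by rewrite -(integral_distribution mE ij) -(integral_distribution mE i1) E.
Qed.

Lemma innovation_mean0 j : (0 < j)%N -> L1 (Z j) /\ \int[P]_x Z j x = 0.
Proof.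
move=> j0; rewrite -[RHS]Zmean; apply: (identically_distributed_L1 (psi := id)) => //.
apply: (@dominated_L1 _ _ _ _ _ (fun x => 1 + Z 1%N x ^+ 2)) => //.
  by apply: L1D => //; exact: L1_cst.
by move=> x; exact: abs_le_1sq.
Qed.

Lemma innovation_sqr j : (0 < j)%N -> L1 (fun x => Z j x ^+ 2) /\ \int[P]_x (Z j x ^+ 2) = sigma ^+ 2.
Proof.
by move=> j0; rewrite -[RHS]Zvar; apply: (identically_distributed_L1 (psi := fun y => y ^+ 2)).
Qed.

(** The product rule is available for bounded functions; truncate both factors
    and let the level of truncation grow. *)
Lemma innovations_uncorrelated i j : (0 < i)%N -> (i < j)%N ->
  L1 (fun x => Z i x * Z j x) /\ \int[P]_x (Z i x * Z j x) = 0.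
Proof.
move=> i0 ij; have j0 : (0 < j)%N by exact: leq_trans ij.
have [i2i _] := innovation_sqr i0; have [i2j _] := innovation_sqr j0.
have dom x : `|Z i x * Z j x| <= Z i x ^+ 2 + Z j x ^+ 2.
  rewrite normrM -(real_normK (num_real (Z i x))) -(real_normK (num_real (Z j x))).
  move: `|Z i x| `|Z j x| => u v.
  have := sqr_ge0 (u - v); have := sqr_ge0 u; have := sqr_ge0 v.
  by rewrite !expr2; lra.
have idom : L1 (fun x => Z i x ^+ 2 + Z j x ^+ 2) by exact: L1D.
split; first by apply: dominated_L1 dom => //; exact: measurable_funM.
(* Truncation by an indicator: bounded by [K], and dominated by the identity. *)
pose phi (K : nat) (y : R) : R := y * \1_[set z | `|z| <= K%:R] y.
have mset K : measurable [set z : R | `|z| <= K%:R].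
  rewrite (_ : [set _ | _] = `[- K%:R, K%:R]%classic); first exact: measurable_itv.
  by apply/seteqP; split => z /=; rewrite in_itv/= ler_norml.
have mphi K : measurable_fun setT (phi K).
  by apply: measurable_funM => //; exact: measurable_indic.
have mpZ k K : measurable_fun setT (fun x => phi K (Z k x)) by apply: measurableT_comp.
have phi_le K y : `|phi K y| <= `|y|.
  by rewrite normrM ler_piMr// indic_norm_le1.
have phiK K y : `|phi K y| <= K%:R.
  rewrite normrM indicE; case: (boolP (y \in _)); rewrite ?inE/= ?normr1 ?normr0 ?mulr0 ?mulr1//.
have phi_cvg y : phi ^~ y @ \oo --> y.
  apply: cvg_near_cst; exists (Num.truncn `|y|).+1 => // n /= hn.
  rewrite /phi indicE mem_set ?mulr1//=; apply: (le_trans (ltW (Num.Theory.truncnS_gt _))).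
  by rewrite ler_nat.
have prodE K : \int[P]_x (phi K (Z i x) * phi K (Z j x)) =
    \int[P]_x phi K (Z i x) * \int[P]_x phi K (Z j x).
  have iF1 := indep_from1 Ziid.1.
  have b1 (x : T) : `|1 : R| <= 1 by rewrite normr1.
  have m1 : measurable_fun setT (fun _ : T => 1 : R) by [].
  have iFi := indep_from_le m1 b1 i0 iF1.
  have [iFi1 _] := indep_from_mul m1 b1 iFi (mphi K) (phiK K).
  have E : (fun x => 1 * phi K (Z i x)) = (fun x => phi K (Z i x)) by apply/funext => x; rewrite mul1r.
  rewrite E in iFi1.
  have mphiZ : measurable_fun setT (fun x => phi K (Z i x)) by exact: measurableT_comp.
  have iFj := indep_from_le mphiZ (fun x => phiK K (Z i x)) ij iFi1.
  by have [] := indep_from_mul mphiZ (fun x => phiK K (Z i x)) iFj (mphi K) (phiK K).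
have c1 : (fun K => \int[P]_x (phi K (Z i x) * phi K (Z j x))) @ \oo --> \int[P]_x (Z i x * Z j x).
  apply: (Rint_dct (g := fun x => Z i x ^+ 2 + Z j x ^+ 2)) => [K|x||K x] //.
  - by apply: measurable_funM.
  - by apply: cvgM; exact: phi_cvg.
  - by apply: le_trans (dom x); rewrite [leRHS]normrM [leLHS]normrM ler_pM ?phi_le.
have c2 k : (0 < k)%N -> (fun K => \int[P]_x phi K (Z k x)) @ \oo --> (0 : R).
  move=> k0; have [ik <-] := innovation_mean0 k0.
  apply: (Rint_dct (g := fun x => `|Z k x|)) => //.
  - exact: L1_norm.
have c3 := cvgM (c2 i i0) (c2 j j0).
rewrite mulr0 in c3.
rewrite (funext prodE) in c1.
by rewrite -(cvg_lim _ c1)//; exact: cvg_lim (c3 _).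
Qed.

Definition block_sum (k l : nat) (x : T) : R := \sum_(k <= j < l) Z j x.

Lemma measurable_block_sum k l : measurable_fun setT (block_sum k l).
Proof. by apply: measurable_sum => j. Qed.

(** The cross terms vanish. *)
Lemma block_sum_sqr k l : (0 < k)%N ->
  L1 (fun x => block_sum k l x ^+ 2) /\ \int[P]_x (block_sum k l x ^+ 2) = (l - k)%:R * sigma ^+ 2.
Proof.
move=> k0.
have block0 m : (m <= k)%N -> (fun x => block_sum k m x ^+ 2) = (fun=> 0).
  by move=> mk; apply/funext => x; rewrite /block_sum big_geq// expr0n.
elim: l => [|l [IHi IHE]].
  by rewrite block0// sub0n mul0r; split; [exact: L1_cst|exact: Rint_cst].
have [lk|kl] := leqP l.+1 k.
  rewrite block0// (eqP (_ : (l.+1 - k == 0)%N)) ?subn_eq0// mul0r.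
  by split; [exact: L1_cst|exact: Rint_cst].
have l0 : (0 < l)%N by exact: leq_trans k0 kl.
have [i2 E2] := innovation_sqr l0.
have [ci cE] : L1 (fun x => block_sum k l x * Z l x) /\ \int[P]_x (block_sum k l x * Z l x) = 0.
  pose F j x := if (k <= j < l)%N then Z j x * Z l x else 0.
  have zz j : L1 (F j) /\ \int[P]_x F j x = 0.
    rewrite /F; case: (boolP (k <= j < l)%N) => [/andP[kj jl]|_]; first by apply: innovations_uncorrelated => //; exact: leq_trans k0 kj.
    by split; [exact: L1_cst|rewrite Rint_cst].
  have -> : (fun x => block_sum k l x * Z l x) = (fun x => \sum_(k <= j < l) F j x).
    apply/funext => x; rewrite /block_sum mulr_suml; apply: eq_big_nat => j jkl.
    by rewrite /F jkl.
  split; first by apply: L1_sum => j; exact: (zz j).1.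
  rewrite Rint_sum; last by move=> j; exact: (zz j).1.
  by apply: big1 => j _; exact: (zz j).2.
have -> : (fun x => block_sum k l.+1 x ^+ 2) =
    (fun x => block_sum k l x ^+ 2 + 2 * (block_sum k l x * Z l x) + Z l x ^+ 2).
  by apply/funext => x; rewrite /block_sum big_nat_recr//=; ring.
have c2i := L1Z 2 ci; have ic := L1D IHi c2i.
split; first exact: L1D.
by rewrite !RintegralD// RintegralZl// cE E2 IHE subSn// -natr1; ring.
Qed.

Lemma block_sum_L1 k l : (0 < k)%N -> L1 (block_sum k l).
Proof.
move=> k0; have [i2 _] := block_sum_sqr l k0.
apply: (@dominated_L1 _ _ _ _ _ (fun x => 1 + block_sum k l x ^+ 2)); first exact: measurable_block_sum.
  by apply: L1D => //; exact: L1_cst.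
by move=> x; exact: abs_le_1sq.
Qed.

(** A Taylor remainder of the characteristic function of an innovation at [t /
    sqrt n] is [o (1 / n)]: dominated convergence, with majorant [t ^ 2 * Z_1 ^
    2]. *)
Lemma remainder_negligible (h : R -> R) (t : R) : small_remainder h ->
  (fun n => n%:R * \int[P]_x h (t / Num.sqrt n%:R * Z 1%N x)) @ \oo --> (0 : R).
Proof.
move=> [mh h2 h3].
have mZ c : measurable_fun setT (fun x => h (c * Z 1%N x)).
  by apply: measurableT_comp => //; exact: measurable_funM.
have dom n x : `|n%:R * h (t / Num.sqrt n%:R * Z 1%N x)| <= t ^+ 2 * Z 1%N x ^+ 2.
  have [->|n0] := posnP n; first by rewrite mul0r normr0 mulr_ge0 ?sqr_ge0.
  rewrite normrM ger0_norm//; apply: (le_trans (ler_wpM2l _ (h2 _))) => //.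
  rewrite !exprMn exprVn sqr_sqrtr// le_eqVlt; apply/orP; left; apply/eqP.
  by field; rewrite pnatr_eq0 -lt0n.
rewrite (_ : (fun n => _) = (fun n => \int[P]_x (n%:R * h (t / Num.sqrt n%:R * Z 1%N x)))); last first.
  apply/funext => n; rewrite RintegralZl//.
  apply: (@dominated_L1 _ _ _ _ _ (fun x => (t / Num.sqrt n%:R) ^+ 2 * Z 1%N x ^+ 2)) => //.
    exact: L1Z.
  by move=> x; rewrite -exprMn.
rewrite -[X in _ --> X](Rint_cst P).
apply: (Rint_dct (g := fun x => t ^+ 2 * Z 1%N x ^+ 2)) => //.
- by move=> n; exact: measurable_funM.
- move=> x; apply: norm_cvg0.
  have c : (fun n => (Num.sqrt n%:R)^-1 * `|t * Z 1%N x| ^+ 3) @ \oo --> (0 : R).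
    by rewrite -[X in _ --> X](mul0r (`|t * Z 1%N x| ^+ 3)); apply: cvgM; [exact: cvg_invsqrt|exact: cvg_cst].
  apply: (@squeeze_cvgr _ _ _ _ (cst 0) _ _ _ _ _ c); last exact: cvg_cst.
  apply: nearW => n; rewrite normr_ge0/=.
  have [->|n0] := posnP n; first by rewrite mul0r normr0 mulr_ge0 ?invr_ge0 ?sqrtr_ge0 ?exprn_ge0.
  rewrite normrM ger0_norm//; apply: (le_trans (ler_wpM2l _ (h3 _))) => //.
  have s0 : Num.sqrt n%:R != 0 :> R by rewrite gt_eqF// sqrtr_gt0 ltr0n.
  rewrite mulrAC normrM exprMn normfV (ger0_norm (sqrtr_ge0 _)) exprVn.
  rewrite le_eqVlt; apply/orP; left; apply/eqP.
  by rewrite -[X in X * _](@sqr_sqrtr _ n%:R)//; field.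
- exact: L1Z.
Qed.

End innovations.

(** * The central limit theorem on trigonometric functions *)

Section trigonometric_clt.
Context d (T : measurableType d) (R : realType) (P : probability T R).
Variables (Z : nat -> {RV P >-> R}) (sigma : R).
Hypothesis Ziid : iid [set j | (0 < j)%N] Z.

Local Notation L1 f := (P.-integrable setT (EFin \o f)).

Hypothesis Zsq : L1 (fun x => Z 1%N x ^+ 2).
Hypothesis Zmean : \int[P]_x Z 1%N x = 0.
Hypothesis Zvar : \int[P]_x (Z 1%N x ^+ 2) = sigma ^+ 2.

Lemma measurable_cosZ (D a : R) (X : T -> R) : measurable_fun setT X ->
  measurable_fun setT (fun x => cos (D * X x + a)).
Proof.
move=> mX; apply: (measurableT_comp (f := cos)).
  by apply: continuous_measurable_fun; exact: continuous_cos.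
by apply: measurable_funD => //; exact: measurable_funM.
Qed.

Variables (k : nat) (G : T -> R).
Hypotheses (k0 : (0 < k)%N) (mG : measurable_fun setT G) (G1 : forall x, `|G x| <= 1).
Hypothesis iG : indep_from Z k G.

Let Gc (D : R) (l : nat) (a : R) (x : T) : R := G x * cos (D * block_sum Z k l x + a).

Let mGc D l a : measurable_fun setT (Gc D l a).
Proof. by apply: measurable_funM => //; apply: measurable_cosZ; exact: measurable_block_sum. Qed.

Let Gc1 D l a x : `|Gc D l a x| <= 1.
Proof. by rewrite normrM mulr_ile1// cos_max. Qed.

Let mcos (D : R) : measurable_fun setT (fun y : R => cos (D * y)).
Proof.
apply: (measurableT_comp (f := cos)) => //.
by apply: continuous_measurable_fun; exact: continuous_cos.
Qed.

Let msin (D : R) : measurable_fun setT (fun y : R => sin (D * y)).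
Proof.
apply: (measurableT_comp (f := sin)) => //.
by apply: continuous_measurable_fun; exact: continuous_sin.
Qed.

Let GcS D l a x : (k <= l)%N -> Gc D l.+1 a x =
  Gc D l a x * cos (D * Z l x) - Gc D l (a - pi / 2) x * sin (D * Z l x).
Proof.
move=> kl; rewrite /Gc /block_sum big_nat_recr//= mulrDr addrA cosBpihalf addrAC cosD.
by ring.
Qed.

(** By the addition formula, adding the innovation [Z_l] to the sum produces two
    terms, each a product of a function of the past and a function of [Z_l].
    The sine of the past is a cosine with the phase shifted by [pi / 2], so the
    induction stays within cosines of arbitrary phase. *)
Lemma indep_cos_block_sum D l a : (k <= l)%N -> indep_from Z l (Gc D l a).
Proof.
move=> /subnKC <-; elim: (l - k)%N a => [|n IHn] a.
  rewrite addn0 => m A mA.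
  have GcE x : Gc D k a x = cos a * G x by rewrite /Gc /block_sum big_geq// mulr0 add0r mulrC.
  have ib : L1 (fun x => G x * \prod_(k <= j < m) \1_(A j) (Z j x)).
    apply: (L1_mul_bounded (bounded_L1 P mG G1) (M := 1)); first exact: prod_indic_measurable.
    exact: prod_indic_bounded.
  under eq_Rintegral do rewrite GcE -mulrA.
  under [in RHS]eq_Rintegral do rewrite GcE.
  by rewrite !RintegralZl// ?iG ?mulrA//; exact: bounded_L1 G1.
rewrite addnS; have := indep_from_mul (mGc D (k + n) a) (Gc1 _ _ a) (IHn a) (mcos D) (fun y => cos_max (D * y)).
have := indep_from_mul (mGc D (k + n) (a - pi / 2)) (Gc1 _ _ _) (IHn _) (msin D) (fun y => sin_max (D * y)).
move=> [i1 _] [i2 _].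
rewrite (_ : Gc D (k + n).+1 a = fun x => Gc D (k + n) a x * cos (D * Z (k + n)%N x) -
   Gc D (k + n) (a - pi / 2) x * sin (D * Z (k + n)%N x)); last first.
  by apply/funext => x; rewrite GcS// leq_addr.
apply: (indep_fromB (M := 1)) => //.
- by apply: measurable_funM => //; apply: measurableT_comp (mcos D) _.
- by move=> x; rewrite normrM mulr_ile1// cos_max.
- by apply: measurable_funM => //; apply: measurableT_comp (msin D) _.
- by move=> x; rewrite normrM mulr_ile1// sin_max.
Qed.

(** The addition formula, in expectation. *)
Lemma trig_step D l a : (k <= l)%N ->
  \int[P]_x Gc D l.+1 a x = \int[P]_x Gc D l a x * \int[P]_x cos (D * Z 1%N x) -
    \int[P]_x Gc D l (a - pi / 2) x * \int[P]_x sin (D * Z 1%N x).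
Proof.
move=> kl; have l0 : (0 < l)%N by exact: leq_trans k0 kl.
have [_ E1] := indep_from_mul (mGc D l a) (Gc1 _ _ a) (indep_cos_block_sum D a kl)
  (mcos D) (fun y => cos_max (D * y)).
have [_ E2] := indep_from_mul (mGc D l (a - pi / 2)) (Gc1 _ _ _) (indep_cos_block_sum D _ kl)
  (msin D) (fun y => sin_max (D * y)).
have mcZ j : measurable_fun setT (fun x => cos (D * Z j x)).
  by apply: measurableT_comp (mcos D) _.
have msZ j : measurable_fun setT (fun x => sin (D * Z j x)).
  by apply: measurableT_comp (msin D) _.
have ib a' : L1 (Gc D l a') by exact: bounded_L1 (Gc1 _ _ _).
under eq_Rintegral do rewrite GcS//.
rewrite RintegralB//.
- rewrite E1 E2.
  have [_ ->] := identically_distributed_L1 Ziid l0 (mcos D) (bounded_L1 P (mcZ 1%N) (fun x => cos_max (D * Z 1%N x))).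
  by have [_ ->] := identically_distributed_L1 Ziid l0 (msin D) (bounded_L1 P (msZ 1%N) (fun x => sin_max (D * Z 1%N x))).
- exact: L1_mul_bounded (fun x => cos_max (D * Z l x)).
- exact: L1_mul_bounded (fun x => sin_max (D * Z l x)).
Qed.

(** All the quantities are bounded by [1], so the errors of the single steps add
    up. *)
Lemma trig_telescope D e : 0 <= e <= 1 -> forall i a,
  `|\int[P]_x Gc D (k + i) a x - e ^+ i * (\int[P]_x G x * cos a)| <=
  i%:R * (`|\int[P]_x cos (D * Z 1%N x) - e| + `|\int[P]_x sin (D * Z 1%N x)|).
Proof.
move=> /andP[e0 e1]; elim=> [|i IHi] a.
  rewrite addn0 expr0 !mul1r mul0r.
  rewrite (_ : Gc D k a = fun x => G x * cos a); last first.
    by apply/funext => x; rewrite /Gc /block_sum big_geq// mulr0 add0r.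
  by rewrite RintegralZr ?subrr ?normr0//; exact: bounded_L1 G1.
rewrite addnS trig_step ?leq_addr//.
set C := \int[P]_x cos _; set S := \int[P]_x sin _.
set b := \int[P]_x Gc _ _ a x; set b' := \int[P]_x Gc _ _ (a - _) x.
have b1 : `|b| <= 1 by exact: Rint_norm_le (Gc1 _ _ _).
have b'1 : `|b'| <= 1 by exact: Rint_norm_le (Gc1 _ _ _).
rewrite (_ : _ - _ = e * (b - e ^+ i * (\int[P]_x G x * cos a)) + b * (C - e) - b' * S); last first.
  by rewrite exprS; ring.
apply: (le_trans (ler_normB _ _)); apply: (le_trans (lerD (ler_normD _ _) (lexx _))).
rewrite -natr1 mulrDl mul1r addrA; apply: lerD; last first.
  by rewrite normrM ler_piMl.
apply: lerD; last by rewrite normrM ler_piMl.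
by rewrite normrM ger0_norm//; apply: le_trans (IHi a); rewrite ler_piMl.
Qed.

(** The telescoping estimate applies to the sum from [k] to [n].  The sum of the
    innovations before [k], divided by [sqrt n], vanishes in [L^1], and [exp (-
    A / n)] raised to the power [n + 1 - k] has the same limit as its [n]-th
    power. *)
Theorem mixing_clt_trig (t a : R) :
  (fun n => \int[P]_x (G x * cos (t * ((Num.sqrt n%:R)^-1 * block_sum Z 1 n.+1 x) + a))) @ \oo -->
    (\int[P]_x G x) * (cos a * expR (- (t ^+ 2 * sigma ^+ 2 / 2))).
Proof.
pose A : R := t ^+ 2 * sigma ^+ 2 / 2.
have A0 : 0 <= A by rewrite divr_ge0// mulr_ge0// sqr_ge0.
pose D n : R := t / Num.sqrt n%:R.
pose e n : R := expR (- (A / n%:R)).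
have An n : 0 <= A / n%:R by rewrite divr_ge0.
have e01 n : 0 <= e n <= 1.
  by rewrite expR_ge0/= -[leRHS]expR0 ler_expR oppr_le0.
(* The error of a single step; it has to be shown that [n * eta n] vanishes. *)
pose eta n := `|\int[P]_x cos (D n * Z 1%N x) - e n| + `|\int[P]_x sin (D n * Z 1%N x)|.
have Dn2 n : (0 < n)%N -> n%:R * D n ^+ 2 = t ^+ 2.
  move=> n0; rewrite exprMn exprVn sqr_sqrtr//; field.
  by rewrite pnatr_eq0 -lt0n.
have mcZ n : measurable_fun setT (fun x => cos (D n * Z 1%N x)) by apply: measurableT_comp (mcos _) _.
have msZ n : measurable_fun setT (fun x => sin (D n * Z 1%N x)) by apply: measurableT_comp (msin _) _.
have icZ n : L1 (fun x => cos (D n * Z 1%N x)) by exact: bounded_L1 (fun x => cos_max _).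
have isZ n : L1 (fun x => sin (D n * Z 1%N x)) by exact: bounded_L1 (fun x => sin_max _).
have [iZ _] := innovation_mean0 Ziid Zsq Zmean (ltnSn 0).
have neta : (fun n => n%:R * eta n) @ \oo --> (0 : R).
  have h1 := remainder_negligible Zsq t (cos_remainder R).
  have h2 := remainder_negligible Zsq t (sin_remainder R).
  have h3 : (fun n : nat => A ^+ 2 * n%:R^-1) @ \oo --> (0 : R).
    by rewrite -[X in _ --> X](mulr0 (A ^+ 2)); apply: cvgM; [exact: cvg_cst|exact: cvg_invn].
  have h1' := cvg_norm h1; have h2' := cvg_norm h2; rewrite normr0 in h1' h2'.
  have hs : (fun n => `|n%:R * \int[P]_x (cos (D n * Z 1%N x) - 1 + (D n * Z 1%N x) ^+ 2 / 2)| +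
      A ^+ 2 * n%:R^-1 + `|n%:R * \int[P]_x (sin (D n * Z 1%N x) - D n * Z 1%N x)|) @ \oo --> (0 : R).
    rewrite -[X in _ --> X](addr0 0); apply: cvgD; last exact: h2'.
    by rewrite -[X in _ --> X](addr0 0); apply: cvgD; [exact: h1'|exact: h3].
  apply: (@squeeze_cvgr _ _ _ _ (cst 0) _ _ _ _ _ hs); last exact: cvg_cst.
  near=> n; have n0 : (0 < n)%N by near: n; exists 1%N.
  rewrite mulr_ge0 ?addr_ge0//= /eta mulrDr.
  have -> : \int[P]_x sin (D n * Z 1%N x) = \int[P]_x (sin (D n * Z 1%N x) - D n * Z 1%N x).
    by rewrite RintegralB//; [rewrite RintegralZl// Zmean mulr0 subr0|exact: L1Z].
  have -> : \int[P]_x cos (D n * Z 1%N x) =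
      \int[P]_x (cos (D n * Z 1%N x) - 1 + (D n * Z 1%N x) ^+ 2 / 2) + 1 - A / n%:R.
    have -> : (fun x => cos (D n * Z 1%N x) - 1 + (D n * Z 1%N x) ^+ 2 / 2) =
        (fun x => cos (D n * Z 1%N x) - 1 + D n ^+ 2 / 2 * Z 1%N x ^+ 2).
      by apply/funext => x; congr (_ + _); rewrite exprMn; ring.
    have i1 := L1_cst P 1.
    have i2 := L1Z (D n ^+ 2 / 2) Zsq.
    have i3 := L1B (icZ n) i1.
    rewrite RintegralD// RintegralB// Rint_cst RintegralZl// Zvar /A.
    rewrite -(Dn2 n n0); set c := \int[P]_x _; move: (D n) => D'; field.
    by rewrite pnatr_eq0 -lt0n.
  rewrite lerD//; last by rewrite normrM normr_nat.
  set c := \int[P]_x _.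
  rewrite (_ : c + 1 - _ - e n = c - (e n - 1 + A / n%:R)); last by ring.
  apply: (le_trans (ler_wpM2l _ (ler_normB _ _))) => //.
  rewrite mulrDr lerD//; first by rewrite normrM normr_nat.
  apply: (le_trans (ler_wpM2l _ (expRN_remainder (An n)))) => //.
  rewrite le_eqVlt; apply/orP; left; apply/eqP; field.
  by rewrite pnatr_eq0 -lt0n.
have iB := block_sum_L1 Ziid Zsq Zmean Zvar.
pose m1 := \int[P]_x `|block_sum Z 1 k x|.
(* The three terms bound the removal of the first innovations, the [n] telescoping errors, and the missing powers of [e n]. *)
pose bound n := 2 * `|t| * m1 * (Num.sqrt n%:R)^-1 + n%:R * eta n + k%:R * A * n%:R^-1.
have bound0 : bound @ \oo --> (0 : R).
  rewrite -[X in _ --> X](addr0 0); apply: cvgD.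
    rewrite -[X in _ --> X](addr0 0); apply: cvgD => //.
    by rewrite -[X in _ --> X](mulr0 (2 * `|t| * m1)); apply: cvgM; [exact: cvg_cst|exact: cvg_invsqrt].
  by rewrite -[X in _ --> X](mulr0 (k%:R * A)); apply: cvgM; [exact: cvg_cst|exact: cvg_invn].
apply/subr_cvg0; apply: norm_cvg0.
apply: (@squeeze_cvgr _ _ _ _ (cst 0) _ _ _ _ _ bound0); last exact: cvg_cst.
near=> n; rewrite normr_ge0/=.
have n0 : (0 < n)%N by near: n; exists 1%N.
have kn : (k <= n)%N by near: n; exists k.
pose X1 := \int[P]_x Gc (D n) n.+1 a x.
pose g := \int[P]_x G x * cos a.
have g1 : `|g| <= 1.
  rewrite normrM mulr_ile1 ?cos_max//.
  exact: Rint_norm_le G1.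
have eX m : e n ^+ m = expR (- (m%:R * (A / n%:R))) by rewrite -mulrN expRM_natl.
pose i := (n.+1 - k)%N.
have ki : n.+1 = (k + i)%N by rewrite subnKC// leqW.
have in_ : (i <= n)%N by rewrite leq_subLR -(addn1 n) addnC leq_add2r.
rewrite (_ : _ - _ = (\int[P]_x (G x * cos (t * ((Num.sqrt n%:R)^-1 * block_sum Z 1 n.+1 x) + a)) - X1)
   + (X1 - e n ^+ i * g) + (e n ^+ i - expR (- A)) * g); last by rewrite /g /A; ring.
apply: (le_trans (ler_normD _ _)); apply: (le_trans (lerD (ler_normD _ _) (lexx _))).
rewrite /bound; apply: lerD; first apply: lerD.
- have mb1 : measurable_fun setT (fun x => block_sum Z 1 n.+1 x) by exact: measurable_block_sum.
  rewrite (_ : 2 * `|t| * m1 * _ = \int[P]_x (2 * `|D n| * `|block_sum Z 1 k x|)); last first.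
    rewrite RintegralZl//; last exact/L1_norm/iB.
    by rewrite /D /m1 normrM normfV (ger0_norm (sqrtr_ge0 _)); ring.
  apply: Rint_dist_le.
  + apply: L1_mul_bounded (bounded_L1 P mG G1) _ (fun x => cos_max _).
    apply: (measurable_cosZ t a (X := fun x => (Num.sqrt n%:R)^-1 * block_sum Z 1 n.+1 x)).
    exact: measurable_funM.
  + exact: bounded_L1 (Gc1 _ _ _).
  + exact/L1Z/L1_norm/iB.
  + move=> x; rewrite -mulrBr normrM; apply: (@le_trans _ _ (1 * (2 * `|D n * block_sum Z 1 k x|))).
      apply: ler_pM => //; rewrite (_ : _ * _ + a = (D n * block_sum Z k n.+1 x + a) + D n * block_sum Z 1 k x).
        exact: cos_lipschitz.
      rewrite /block_sum (@big_cat_nat _ _ _ k 1%N n.+1)//=; last exact: leqW.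
      by rewrite /D; ring.
    by rewrite mul1r normrM mulrA.
- rewrite /X1 ki; apply: le_trans (trig_telescope _ (e01 n) i a) _.
  by rewrite -/(eta n) ler_wpM2r ?addr_ge0// ler_nat.
- rewrite normrM; apply: (@le_trans _ _ (`|e n ^+ i - expR (- A)| * 1)); first by rewrite ler_wpM2l.
  have en : e n ^+ n = expR (- A).
    by rewrite eX; congr (expR (- _)); field; rewrite pnatr_eq0 -lt0n.
  have en' : e n ^+ n = e n ^+ i * e n ^+ (n - i) by rewrite -exprD subnKC.
  rewrite mulr1 -en en' -[X in `|X - _|]mulr1 -mulrBr normrM.
  have /andP[e0 e1] := e01 n.
  have p0 m : 0 <= e n ^+ m by exact: exprn_ge0.
  have p1 m : e n ^+ m <= 1 by exact: exprn_ile1.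
  rewrite !ger0_norm ?subr_ge0//.
  apply: (@le_trans _ _ (1 - e n ^+ (n - i))); first by rewrite ler_piMl ?subr_ge0.
  have := expR_ge1Dx (- ((n - i)%:R * (A / n%:R))); rewrite -eX => h.
  apply: (@le_trans _ _ ((n - i)%:R * (A / n%:R))); first by lra.
  rewrite -mulrA ler_wpM2r// ler_nat leq_subLR.
  by move: ki; lia.
Unshelve. all: by end_near. Qed.

End trigonometric_clt.

(** * The characteristic function of the normal law *)

Section normal_characteristic_function.
Variable R : realType.
Local Notation leb := (@lebesgue_measure R).
Local Notation phi := (normal_pdf (0 : R) 1).

(** The density of the normal law is its Radon-Nikodym derivative with respect
    to the Lebesgue measure. *)
Lemma integral_normal_prob (h : R -> R) (M : R) : measurable_fun setT h ->
  (forall x, `|h x| <= M) ->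
  \int[normal_prob (0 : R) 1]_x h x = \int[leb]_x (h x * phi x).
Proof.
move=> mh hM.
have hi : (normal_prob (0 : R) 1).-integrable setT (EFin \o h) by exact: (bounded_L1 (normal_prob (0 : R) 1 : probability _ R) mh hM).
rewrite /Rintegral; congr fine; under [in RHS]eq_integral do rewrite EFinM.
rewrite -(Radon_Nikodym_change_of_variables (normal_prob_dominates 0 1))//=.
apply: ae_eq_integral => //.
- apply: emeasurable_funM => //; first exact/measurable_EFinP.
  apply: (measurable_int leb).
  by apply: Radon_Nikodym_integrable; exact: normal_prob_dominates.
- apply: emeasurable_funM => //; first exact/measurable_EFinP.
  by apply/measurable_EFinP; exact: measurable_normal_pdf.
- apply: ae_eqe_mul2l => /=.
  rewrite Radon_NikodymE//=; first exact: normal_prob_dominates.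
  move=> abmu; case: cid => /= k [k1 k2 k3].
  apply: integral_ae_eq => //=.
  + by apply/measurable_EFinP; exact: measurable_normal_pdf.
  + by move=> E E01 mE; rewrite -k3.
Qed.

Lemma pdfE x : phi x = normal_peak 1 * expR (- (x ^+ 2 / 2)).
Proof. by rewrite normal_pdfE ?oner_neq0// /normal_fun subr0 expr1n mulNr. Qed.

Lemma pdf_ge0 x : 0 <= phi x. Proof. exact: normal_pdf_ge0. Qed.

Lemma pdf_integrable : leb.-integrable setT (EFin \o phi).
Proof. exact: integrable_normal_pdf. Qed.

Lemma derive_pdf (x : R) : is_derive x 1 phi (- x * phi x).
Proof.
rewrite (_ : phi = fun x => normal_peak 1 * expR (- (x ^+ 2 / 2))); last first.
  by apply/funext => y; rewrite pdfE.
have d1 : is_derive x 1 (fun y : R => - (y ^+ 2 / 2)) (- x).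
  by apply: is_derive_eq; rewrite /GRing.scale /=; field.
have d2 := is_derive1_comp (is_derive_expR _) d1.
have d3 := is_deriveZ (normal_peak 1) d2.
apply: is_derive_eq d3 _.
by rewrite /GRing.scale /=; ring.
Qed.

(** As [|x| <= exp (x ^ 2 / 4)], the function is dominated by a multiple of the
    density of variance [2]. *)
Lemma abs_pdf_integrable : leb.-integrable setT (EFin \o (fun x => `|x| * phi x)).
Proof.
pose s : R := Num.sqrt 2.
have s0 : s != 0 by rewrite gt_eqF// sqrtr_gt0.
pose c : R := normal_peak 1 / normal_peak s.
have : leb.-integrable setT (fun x => (c%:E * (normal_pdf 0 s x)%:E)%E).
  by apply: integrableZl => //; exact: integrable_normal_pdf.
apply: le_integrable => //.
  apply/measurable_EFinP; apply: measurable_funM; last exact: measurable_normal_pdf.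
  exact: normr_measurable.
move=> x _ /=; rewrite lee_fin.
have ps : 0 < normal_peak s by exact: normal_peak_gt0.
rewrite ger0_norm ?mulr_ge0 ?pdf_ge0// [leRHS]ger0_norm; last first.
  by rewrite mulr_ge0 ?normal_pdf_ge0// divr_ge0 ?normal_peak_ge0.
have -> : normal_pdf 0 s x = normal_peak s * expR (- x ^+ 2 / (2 *+ 2)).
  by rewrite normal_pdfE// /normal_fun subr0 /s sqr_sqrtr.
rewrite pdfE /c [leRHS]mulrA divfK ?gt_eqF// mulrCA ler_wpM2l ?normal_peak_ge0//.
rewrite (_ : - (x ^+ 2 / 2) = - (x ^+ 2 / 4) + (- x ^+ 2 / (2 *+ 2))); last by field.
rewrite expRD mulrA ler_piMl ?expR_ge0//.
rewrite expRN ler_pdivrMr ?expR_gt0// mul1r.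
apply: le_trans (expR_ge1Dx _); rewrite -(real_normK (num_real x)).
have := sqr_ge0 (`|x| / 2 - 1); rewrite !expr2; lra.
Qed.

Variable a : R.
Let g (t x : R) : R := cos (t * x + a) * phi x.
Let k (t x : R) : R := sin (t * x + a) * (x * phi x).

Let cont_affine t : continuous (fun x : R => t * x + a).
Proof.
by move=> x; apply: cvgD; [apply: cvgM; [exact: cvg_cst|exact: cvg_id]|exact: cvg_cst].
Qed.

Let ccos t : continuous (fun x : R => cos (t * x + a)).
Proof.
move=> x; apply: (@continuous_comp _ _ _ (fun x => t * x + a) cos).
  exact: cont_affine.
exact: continuous_cos.
Qed.

Let csin t : continuous (fun x : R => sin (t * x + a)).
Proof.
move=> x; apply: (@continuous_comp _ _ _ (fun x => t * x + a) sin).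
  exact: cont_affine.
exact: continuous_sin.
Qed.

Let cphi : continuous phi.
Proof. by apply: continuous_normal_pdf; exact: oner_neq0. Qed.

Let ck t : continuous (k t).
Proof.
move=> x; apply: cvgM; first exact: csin.
by apply: cvgM; [exact: cvg_id|exact: cphi].
Qed.

Let cg t : continuous (g t).
Proof. by move=> x; apply: cvgM; [exact: ccos|exact: cphi]. Qed.

Let gi t : leb.-integrable setT (EFin \o g t).
Proof.
apply: le_integrable pdf_integrable => //.
  by apply/measurable_EFinP; apply: continuous_measurable_fun; exact: cg.
move=> x _ /=; rewrite lee_fin normrM ler_piMl//; exact: cos_max.
Qed.

Let ki t : leb.-integrable setT (EFin \o k t).
Proof.
apply: le_integrable abs_pdf_integrable => //.
  by apply/measurable_EFinP; apply: continuous_measurable_fun; exact: ck.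
move=> x _ /=; rewrite lee_fin normrM !normrM normr_id ler_piMl//; exact: sin_max.
Qed.

Let dg (t x : R) : is_derive x 1 (fun y => sin (t * y + a) * phi y) (t * g t x - k t x).
Proof.
have d1 : is_derive x 1 (fun y : R => t * y + a) t.
  by apply: is_derive_eq; rewrite /GRing.scale /=; ring.
have d2 := is_derive1_comp (is_derive_sin _) d1.
have d3 := is_deriveM d2 (derive_pdf x).
apply: is_derive_eq d3 _.
by rewrite /GRing.scale /g /k /=; ring.
Qed.

Let phi_cvg0 : (fun n : nat => phi n%:R) @ \oo --> (0 : R).
Proof.
have h : (fun n : nat => 2 * normal_peak 1 * n%:R^-1) @ \oo --> (0 : R).
  by rewrite -[X in _ --> X](mulr0 (2 * normal_peak 1)); apply: cvgM; [exact: cvg_cst|exact: cvg_invn].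
apply: (@squeeze_cvgr _ _ _ _ (cst 0) _ _ _ _ _ h); last exact: cvg_cst.
near=> n; have n0 : 0 < n%:R :> R by rewrite ltr0n; near: n; exists 1%N.
rewrite pdf_ge0/= pdfE -mulrA mulrCA ler_wpM2l ?normal_peak_ge0//.
rewrite expRN -[leRHS]invrK lef_pV2 ?posrE ?expR_gt0 ?invr_gt0 ?divr_gt0//.
rewrite invf_div; apply: le_trans (expR_ge1Dx _).
have n1 : 1 <= n%:R :> R by rewrite ler1n; near: n; exists 1%N.
have := sqr_ge0 (n%:R - 1 : R); rewrite !expr2; lra.
Unshelve. all: by end_near. Qed.

(** Stein's identity: the difference of the two sides is the integral over the
    line of the derivative of [x |-> sin (t x + a) phi x], which vanishes at
    infinity. *)
Let stein t : \int[leb]_x k t x = t * \int[leb]_x g t x.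
Proof.
pose h x := t * g t x - k t x.
have tgi : leb.-integrable setT (EFin \o (fun x => t * g t x)).
  exact: (integrableZl measurableT t (gi t)).
have hi : leb.-integrable setT (EFin \o h).
  exact: (integrableB measurableT tgi (ki t)).
have ch : continuous h.
  move=> x; apply: cvgB; last exact: ck.
  by apply: cvgM; [exact: cvg_cst|exact: cg].
have mh : measurable_fun setT h by exact: continuous_measurable_fun.
suff : \int[leb]_x h x = 0.
  by rewrite RintegralB// RintegralZl// => /eqP; rewrite subr_eq0 => /eqP ->.
pose I n : set R := `[- n%:R, n%:R]%classic.
have IE n : (0 < n)%N -> (\int[leb]_(x in I n) (h x)%:E)%E =
    (sin (t * n%:R + a) * phi n%:R - sin (t * - n%:R + a) * phi (- n%:R))%:E.
  move=> n0; rewrite EFinB; apply: (continuous_FTC2 (F := fun y => sin (t * y + a) * phi y)).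
  - by rewrite -subr_gt0 opprK -natrD ltr0n addn_gt0 n0.
  - exact: continuous_subspaceT.
  - have cF : continuous (fun y => sin (t * y + a) * phi y).
      by move=> x; apply: cvgM; [exact: csin|exact: cphi].
    split=> [x _||].
    + by have [] := dg t x.
    + exact/cvg_at_right_filter/cF.
    + exact/cvg_at_left_filter/cF.
  - by move=> x _; rewrite derive1E; exact: derive_val.
have c1 : (fun n => \int[leb]_(x in I n) h x) @ \oo --> (0 : R).
  apply: norm_cvg0.
  have h2 : (fun n : nat => phi n%:R + phi n%:R) @ \oo --> (0 : R).
    by rewrite -[X in _ --> X](addr0 0); apply: cvgD.
  apply: (@squeeze_cvgr _ _ _ _ (cst 0) _ _ _ _ _ h2); last exact: cvg_cst.
  near=> n; rewrite normr_ge0/= /Rintegral IE/=; last by near: n; exists 1%N.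
  have -> : phi (- n%:R) = phi n%:R by rewrite !pdfE sqrrN.
  apply: (le_trans (ler_normB _ _)); rewrite !normrM (ger0_norm (pdf_ge0 _)).
  by rewrite lerD// ler_piMl ?pdf_ge0// sin_max.
have c2 : (fun n => \int[leb]_(x in I n) h x) @ \oo --> \int[leb]_x h x.
  have mI n : measurable (I n) by exact: measurable_itv.
  have [] := @dominated_convergence _ _ _ leb _ measurableT
    (fun n => EFin \o (h \_ (I n))) (EFin \o h) (EFin \o (fun x => `|h x|)).
  - move=> n; apply/measurable_EFinP; apply: (measurable_restrictT h (mI n)).1.
    apply: measurable_funTS; exact: mh.
  - exact/measurable_EFinP.
  - apply: aeW => x _; apply: cvg_near_cst.
    exists (Num.truncn `|x|).+1 => // n /= hn; rewrite patchE mem_set//.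
    rewrite /I/= in_itv/= -ler_norml; apply: (le_trans (ltW (Num.Theory.truncnS_gt _))).
    by rewrite ler_nat.
  - exact: integrable_norm.
  - apply: aeW => x n _ /=; rewrite lee_fin patchE; case: ifP => // _.
    by rewrite normr0.
  move=> _ _ hc; under eq_fun do rewrite Rintegral_mkcond.
  rewrite /Rintegral; apply: fine_cvg => /=; rewrite fineK//.
  exact: integrable_fin_num.
by rewrite -(cvg_lim _ c2)//; exact: cvg_lim c1.
Unshelve. all: by end_near. Qed.

Let F t := \int[leb]_x g t x.

Let dF (t : R) : is_derive t 1 F (- t * F t).
Proof.
have It : (`]t - 1, t + 1[%classic : set R) t by rewrite /= in_itv/=; apply/andP; split; lra.
have dgt (x s : R) : is_derive s 1 (g ^~ x) (- k s x).
  have d1 : is_derive s 1 (fun y : R => y * x + a) x.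
    by apply: is_derive_eq; rewrite /GRing.scale /=; ring.
  have d2 := is_derive1_comp (is_derive_cos _) d1.
  have d3 := is_deriveM d2 (is_derive_cst (phi x) s 1).
  apply: is_derive_eq d3 _.
  by rewrite /GRing.scale /k /cst /=; ring.
have pE s x : partial1of2 g s x = - k s x by rewrite partial1of2E; exact: derive_val.
have dg1 s x : `]t - 1, t + 1[%classic s -> [set: R] x -> derivable (g ^~ x) s 1.
  by move=> _ _; have [] := dgt x s.
have Gub s x : `]t - 1, t + 1[%classic s -> [set: R] x -> `|partial1of2 g s x| <= `|x| * phi x.
  move=> _ _; rewrite pE normrN !normrM (ger0_norm (pdf_ge0 _)) ler_piMl ?sin_max//.
  by rewrite mulr_ge0// pdf_ge0.
have G0 x : 0 <= `|x| * phi x by rewrite mulr_ge0// pdf_ge0.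
apply: DeriveDef.
  exact: (derivable_under_integral measurableT It (fun s _ => gi s) dg1 G0 abs_pdf_integrable Gub).
rewrite -derive1E (differentiation_under_integral measurableT It (fun s _ => gi s) dg1 G0 abs_pdf_integrable Gub).
under eq_Rintegral do rewrite pE -mulN1r.
by rewrite RintegralZl// stein -/(F t); ring.
Qed.

(** By differentiation under the integral sign and Stein's identity, [F t = E
    cos (t N + a)] solves [F' = - t F]; so [F t * exp (t ^ 2 / 2)] is constant.
    *)
Theorem normal_char (t : R) :
  \int[normal_prob (0 : R) 1]_x cos (t * x + a) = cos a * expR (- (t ^+ 2 / 2)).
Proof.
rewrite (@integral_normal_prob _ 1); [|exact: continuous_measurable_fun|by move=> x; exact: cos_max].
have F0 : F 0 = cos a.
  rewrite /F /g; under eq_Rintegral do rewrite mul0r add0r.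
  rewrite RintegralZl//; last exact: pdf_integrable.
  by rewrite /Rintegral integral_normal_pdf/= mulr1.
(* The product has zero derivative by the differential equation for [F]. *)
pose H s := F s * expR (s ^+ 2 / 2).
have dH (s : R) : is_derive s 1 H 0.
  have d1 : is_derive s 1 (fun y : R => y ^+ 2 / 2) s.
    by apply: is_derive_eq; rewrite /GRing.scale /=; field.
  have d2 := is_derive1_comp (is_derive_expR _) d1.
  have d3 := is_deriveM (dF s) d2.
  apply: is_derive_eq d3 _.
  by rewrite /GRing.scale /=; ring.
have Hc : H t = H 0 by exact: is_derive_0_is_cst.
rewrite -[LHS]/(F t) -F0.
have -> : F 0 = H 0 by rewrite /H expr0n/= mul0r expR0 mulr1.
by rewrite -Hc /H -mulrA -expRD subrr expR0 mulr1.
Qed.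

End normal_characteristic_function.

(** * Bernstein approximation in the variable sine *)

Section bernstein.
Variable R : realType.
Implicit Types (u : R) (phi psi : nat -> R).

(** The expectation of [phi] at a binomial variable with parameters [n] and [u],
    by conditioning on the first trial.  The recursion replaces the explicit sum
    of binomial weights: means, variances and comparisons all follow by
    induction on [n]. *)
Fixpoint binomial_mean (n : nat) phi u : R :=
  if n is n'.+1 then (1 - u) * binomial_mean n' phi u + u * binomial_mean n' (phi \o S) u else phi 0%N.

(** Variance plus squared bias of the binomial law. *)
Lemma binomial_mean_sqr n (c u : R) :
  binomial_mean n (fun k => (k%:R - c) ^+ 2) u = n%:R * u * (1 - u) + (n%:R * u - c) ^+ 2.
Proof.
elim: n c => [|n IHn] c /=; first by ring.
rewrite IHn (_ : _ \o S = fun k => (k%:R - (c - 1)) ^+ 2) ?IHn -?natr1; first by ring.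
by apply/funext => k /=; rewrite -natr1; congr (_ ^+ 2); ring.
Qed.

Lemma binomial_mean_affine n (al be u : R) psi :
  binomial_mean n (fun k => al + be * psi k) u = al + be * binomial_mean n psi u.
Proof.
elim: n psi => [|n IHn] psi //=.
by rewrite (_ : _ \o S = fun k => al + be * (psi \o S) k)// !IHn; ring.
Qed.

Lemma binomial_mean_dist n (A u : R) phi psi : 0 <= u <= 1 ->
  (forall k, `|A - phi k| <= psi k) -> `|A - binomial_mean n phi u| <= binomial_mean n psi u.
Proof.
move=> u01; have /andP[u0 u1] := u01; elim: n phi psi => [|n IHn] phi psi H //=.
rewrite (_ : A - _ = (1 - u) * (A - binomial_mean n phi u) + u * (A - binomial_mean n (phi \o S) u)); last by ring.
apply: (le_trans (ler_normD _ _)); rewrite !normrM (ger0_norm u0) ger0_norm ?subr_ge0//.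
rewrite lerD// ler_wpM2l ?subr_ge0//; first exact: IHn.
by apply: IHn => k; exact: H.
Qed.

Lemma binomial_mean_bounded n (M u : R) phi : 0 <= u <= 1 -> (forall k, `|phi k| <= M) -> `|binomial_mean n phi u| <= M.
Proof.
move=> u01 H; have := @binomial_mean_dist n 0 u phi (fun=> M) u01.
rewrite sub0r normrN; have -> : binomial_mean n (fun=> M) u = M.
  by elim: n => [//|n IHn] /=; rewrite (_ : (fun=> M) \o S = fun=> M)// IHn; ring.
by apply => k; rewrite sub0r normrN.
Qed.

(** Chebyshev's argument: the quadratic modulus of continuity is averaged
    against a binomial law of variance [n u (1 - u)]. *)
Lemma bernstein_approx (H : R -> R) (e K u : R) n : (0 < n)%N -> 0 <= u <= 1 -> 0 <= K ->
  (forall w, `|H u - H w| <= e + K * (u - w) ^+ 2) ->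
  `|H u - binomial_mean n (fun k => H (k%:R / n%:R)) u| <= e + K / n%:R.
Proof.
move=> n0 u01 K0 HK; have n0' : n%:R != 0 :> R by rewrite pnatr_eq0 -lt0n.
apply: (@le_trans _ _ (binomial_mean n (fun k => e + K / n%:R ^+ 2 * (k%:R - n%:R * u) ^+ 2) u)).
  apply: binomial_mean_dist => // k; apply: (le_trans (HK _)).
  by rewrite le_eqVlt; apply/orP; left; apply/eqP; field.
rewrite binomial_mean_affine binomial_mean_sqr subrr expr0n addr0 lerD2l.
rewrite (_ : _ * _ = K / n%:R * (u * (1 - u))); last by field.
rewrite ler_piMr ?divr_ge0//; have /andP[u0 u1] := u01.
have := sqr_ge0 u; rewrite expr2; lra.
Qed.

End bernstein.

Section uniform_continuity.
Variables (R : realType) (V : pseudoMetricType R) (L : R -> V) (g : V -> R).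
Hypotheses (cL : continuous L) (cg : continuous g).

(** Uniform continuity of [g] at the points of the compact curve [L] restricted
    to a bounded interval; the nearby point [v] need not lie on the curve. *)
Lemma unif_near_curve (K e : R) : 0 < e -> exists2 r : R, 0 < r &
  forall x, `|x| <= K -> forall v, ball (L x) r v -> `|g (L x) - g v| <= e.
Proof.
move=> e0; have e2 : 0 < e / 2 by rewrite divr_gt0.
have : compact `[- K, K]%classic by exact: segment_compact.
move=> /compact_near_coveringP H.
have := @H R (0 : R)^'+ (fun r x => forall v, ball (L x) r v -> `|g (L x) - g v| <= e) _.
case=> [x xK|r /= r0 Hr].
  have /cvgrPdist_le/(_ _ e2) : g v @[v --> L x] --> g (L x) by exact: cg.
  move=> /nbhs_ballP[r /= r0 rg].
  have r2 : 0 < r / 2 by rewrite divr_gt0.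
  have Lx : \forall x' \near x, ball (L x) (r / 2) (L x').
    have Lc : L y @[y --> x] --> L x by exact: cL.
    by apply: Lc; exact: nbhsx_ballx.
  exists ([set x' | ball (L x) (r / 2) (L x')], [set r' | r' <= r / 2]) => /=.
    by split => //; exact: nbhs_right_le.
  move=> [x' r'] /= [h1 h2] v h3.
  have h4 := rg (L x') (le_ball (_ : r / 2 <= r) h1).
  have h5 : `|g (L x) - g v| <= e / 2.
    by apply: rg; rewrite [r]splitr; apply: ball_triangle h1 _; exact: le_ball h3.
  rewrite (_ : _ - _ = (g (L x) - g v) - (g (L x) - g (L x'))); last by ring.
  apply: (le_trans (ler_normB _ _)); rewrite [e]splitr lerD// h4//.
  by lra.
exists (r / 2); first by rewrite divr_gt0.
move=> x xK v; apply: (Hr (r / 2)) => //=.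
- by rewrite sub0r normrN gtr0_norm ?divr_gt0//; lra.
- by rewrite divr_gt0.
- by rewrite in_itv/= -ler_norml.
Qed.

End uniform_continuity.

Section sine_window.
Variable R : realType.

(** On [[- K, K]] the map [x |-> (1 + sin (x / (2 K))) / 2] into [[0, 1]] has a
    continuous left inverse defined everywhere: the arcsine of a value clamped
    to [[- sin (1/2), sin (1/2)]], away from the end points where the arcsine is
    not smooth. *)
Lemma sine_window (K : R) : 0 < K -> exists2 w : R -> R, continuous w &
  forall x, `|x| <= K -> w ((1 + sin (x / (2 * K))) / 2) = x.
Proof.
move=> K0; pose s : R := sin (2^-1).
have pi2 : 1 <= pi / 2 :> R by exact: pihalf_ge1.
have mono : {in `[(- (pi/2)), pi/2]%R &, {mono (@sin R) : x y / x < y}} by exact: ltr_sin.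
have s1 : s < 1.
  rewrite -[ltRHS]sin_pihalf /s mono ?in_itv/=; try by apply/andP; split; lra.
  lra.
have s0 : 0 < s.
  rewrite -[ltLHS]sin0 /s mono ?in_itv/=; try by apply/andP; split; lra.
  lra.
pose c (z : R) := Num.max (- s) (Num.min s z).
have cc : continuous c.
  move=> z; apply: (continuous_max (f := fun=> - s) (g := fun z => Num.min s z)).
    exact: cvg_cst.
  by apply: (continuous_min (f := fun=> s) (g := id)); [exact: cvg_cst|exact: cvg_id].
have cb z : - 1 < c z < 1.
  by rewrite /c lt_max gt_max gt_min ltrN2 s1/= andbT; lra.
have c1 : continuous (fun v : R => 2 * v - 1).
  by move=> v; apply: cvgB; [apply: cvgM; [exact: cvg_cst|exact: cvg_id]|exact: cvg_cst].
have c2 : continuous (fun v : R => c (2 * v - 1)).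
  by move=> v; apply: (@continuous_comp _ _ _ (fun v : R => 2 * v - 1) c); [exact: c1|exact: cc].
have c3 : continuous (fun v : R => asin (c (2 * v - 1))).
  move=> v; apply: (@continuous_comp _ _ _ (fun v : R => c (2 * v - 1)) asin); first exact: c2.
  by apply: continuous_asin; exact: cb.
exists (fun v : R => 2 * K * asin (c (2 * v - 1))).
  by move=> v; apply: cvgM; [exact: cvg_cst|exact: c3].
move=> x xK; set y := x / (2 * K).
have yb : - 2^-1 <= y <= 2^-1.
  rewrite -ler_norml /y normrM normfV (gtr0_norm (_ : 0 < 2 * K)) ?mulr_gt0//.
  by rewrite ler_pdivrMr ?mulr_gt0//; lra.
have /andP[y1 y2] := yb.
have sy : - s <= sin y <= s.
  rewrite -sinN; apply/andP; split; rewrite leNgt mono ?in_itv/= -?leNgt//; apply/andP; split; lra.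
have -> : c (2 * ((1 + sin y) / 2) - 1) = sin y.
  rewrite (_ : 2 * _ - 1 = sin y); last by field.
  by have /andP[sy1 sy2] := sy; rewrite /c min_r// max_r.
rewrite sinK ?in_itv/=; last by apply/andP; split; lra.
by rewrite /y; field; rewrite gt_eqF.
Qed.

End sine_window.

(** * From trigonometric functions to continuous functions *)

Lemma exceeds_split (R : realType) (z K M e D : R) : 0 <= e ->
  (`|z| <= K -> D <= e) -> D <= M -> D <= e + M * \1_[set y | K < `|y|] z.
Proof.
move=> e0 h1 h2; rewrite indicE; have [zK|zK] := leP `|z| K.
  by rewrite memNset/= ?mulr0 ?addr0; [exact: h1|apply/negP; rewrite -leNgt].
by rewrite mem_set//= mulr1; apply: (le_trans h2); rewrite lerDr.
Qed.

Section tightness.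
Context d (T : measurableType d) (R : realType) (P : probability T R).

Local Notation L1 f := (P.-integrable setT (EFin \o f)).

Definition exceeds (X : T -> R) (K : R) (x : T) : R := \1_[set y | K < `|y|] (X x).

Lemma exceeds_measurable X K : measurable_fun setT X -> measurable_fun setT (exceeds X K).
Proof.
move=> mX; apply: measurableT_comp => //; apply: measurable_indic.
rewrite (_ : [set y | _] = ~` `[- K, K]%classic); first by apply: measurableC; exact: measurable_itv.
apply/seteqP; split => y /=; rewrite in_itv/= -ler_norml => h.
  by apply/negP; rewrite -ltNge.
by rewrite ltNge; apply/negP.
Qed.

Lemma exceeds_ge0 X K x : 0 <= exceeds X K x.
Proof. by rewrite /exceeds indicE. Qed.

Lemma exceeds_L1 X K : measurable_fun setT X -> L1 (exceeds X K).
Proof.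
move=> mX; apply: (@bounded_L1 _ _ _ _ _ 1); first exact: exceeds_measurable.
by move=> x; exact: indic_norm_le1.
Qed.

Lemma exceeds_small (X : T -> R) (e : R) : measurable_fun setT X -> 0 < e ->
  exists K0 : nat, forall K : R, K0%:R <= K -> \int[P]_x exceeds X K x <= e.
Proof.
move=> mX e0.
have : (fun K : nat => \int[P]_x exceeds X K%:R x) @ \oo --> (0 : R).
  rewrite -[X in _ --> X](Rint_cst P); apply: (Rint_dct (g := fun=> 1)).
  - by move=> K; exact: exceeds_measurable.
  - move=> x; apply: cvg_near_cst; exists (Num.truncn `|X x|).+1 => // n /= hn.
    rewrite /exceeds indicE memNset//=; apply/negP; rewrite -leNgt.
    by apply: (le_trans (ltW (Num.Theory.truncnS_gt _))); rewrite ler_nat.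
  - exact: L1_cst.
  - by move=> K x; exact: indic_norm_le1.
move=> /cvgrPdist_le/(_ _ e0)[N _ /(_ N (leqnn N))]; rewrite sub0r normrN => h.
exists N => K NK; apply: le_trans (le_trans (ler_norm _) h).
apply: le_Rint; [exact: exceeds_L1|exact: exceeds_L1|move=> x].
rewrite /exceeds !indicE; case: (boolP (X x \in [set y | K < `|y|])) => [|_]; last by case: (_ \in _).
by rewrite inE/= => h'; rewrite mem_set//=; exact: le_lt_trans h'.
Qed.

Lemma exceeds_chebyshev (X : T -> R) (V K : R) : measurable_fun setT X ->
  L1 (fun x => X x ^+ 2) -> \int[P]_x (X x ^+ 2) <= V -> 0 < K ->
  \int[P]_x exceeds X K x <= V / K ^+ 2.
Proof.
move=> mX iX XV K0.
rewrite ler_pdivlMr ?exprn_gt0//; apply: le_trans XV.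
rewrite -RintegralZr//; last exact: exceeds_L1.
apply: le_Rint => //.
  by under eq_fun do rewrite mulrC; apply: L1Z; exact: exceeds_L1.
move=> x; rewrite /exceeds indicE; have [xK|xK] := leP `|X x| K.
  by rewrite memNset/= ?mul0r ?sqr_ge0//; apply/negP; rewrite -leNgt.
by rewrite mem_set//= mul1r -(real_normK (num_real (X x))) lerXn2r ?nnegrE ?(ltW K0)// ltW.
Qed.

End tightness.

Section weak_convergence.
Context d (T : measurableType d) (R : realType) (P : probability T R).
Context d' (T' : measurableType d') (Q : probability T' R).
Variables (xi : nat -> T -> R) (Y : T' -> R) (G : T -> R).
Hypotheses (mxi : forall n, measurable_fun setT (xi n)) (mY : measurable_fun setT Y).
Hypotheses (mG : measurable_fun setT G) (G1 : forall x, `|G x| <= 1).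

Definition tight_seq := forall e : R, 0 < e -> exists K0 : nat, forall K : R, K0%:R <= K ->
  forall n, \int[P]_x exceeds (xi n) K x <= e.

Definition weak_cvg (q : R -> R) :=
  (fun n => \int[P]_x (G x * q (xi n x))) @ \oo --> (\int[P]_x G x) * \int[Q]_y q (Y y).

Let good (q : R -> R) :=
  [/\ measurable_fun setT q, exists M, forall y, `|q y| <= M & weak_cvg q].

Let Gint : P.-integrable setT (EFin \o G). Proof. exact: bounded_L1 G1. Qed.

Let Gq_int (q : R -> R) M n : measurable_fun setT q -> (forall y, `|q y| <= M) ->
  P.-integrable setT (EFin \o (fun x => G x * q (xi n x))).
Proof.
move=> mq qM; apply: L1_mul_bounded Gint _ (fun x => qM (xi n x)).
exact: measurableT_comp.
Qed.

Let qY_int (q : R -> R) M : measurable_fun setT q -> (forall y, `|q y| <= M) ->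
  Q.-integrable setT (EFin \o (fun y => q (Y y))).
Proof.
move=> mq qM; apply: bounded_L1 (fun y => qM (Y y)).
exact: measurableT_comp.
Qed.

Let good_eq q1 q2 : q1 =1 q2 -> good q1 -> good q2.
Proof. by move=> /funext ->. Qed.

Let goodD q1 q2 : good q1 -> good q2 -> good (fun y => q1 y + q2 y).
Proof.
move=> [m1 [M1 b1] c1] [m2 [M2 b2] c2]; split.
- exact: measurable_funD.
- by exists (M1 + M2) => y; apply: (le_trans (ler_normD _ _)); exact: lerD.
rewrite /weak_cvg RintegralD//; [|exact: (qY_int m1 b1)|exact: (qY_int m2 b2)].
rewrite mulrDr (_ : (fun n => _) = (fun n => \int[P]_x (G x * q1 (xi n x)) + \int[P]_x (G x * q2 (xi n x)))).
  exact: cvgD.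
apply/funext => n; under eq_Rintegral do rewrite mulrDr.
by rewrite RintegralD//; [exact: (Gq_int n m1 b1)|exact: (Gq_int n m2 b2)].
Qed.

Let goodZ k q : good q -> good (fun y => k * q y).
Proof.
move=> [m1 [M1 b1] c1]; split.
- exact: measurable_funM.
- by exists (`|k| * M1) => y; rewrite normrM ler_wpM2l.
rewrite /weak_cvg RintegralZl//; last exact: (qY_int m1 b1).
rewrite mulrCA (_ : (fun n => _) = (fun n => k * \int[P]_x (G x * q (xi n x)))).
  by apply: cvgM; [exact: cvg_cst|].
apply/funext => n; under eq_Rintegral do rewrite mulrCA.
by rewrite RintegralZl//; exact: (Gq_int n m1 b1).
Qed.

Hypothesis trig : forall t a : R, weak_cvg (fun y => cos (t * y + a)).

Let good_cos t a : good (fun y => cos (t * y + a)).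
Proof.
split; last exact: trig.
  by apply: (measurable_cosZ t a (X := id)).
by exists 1 => y; exact: cos_max.
Qed.

Let good_bernstein (del : R) n phi t a :
  good (fun y => binomial_mean n phi ((1 + sin (y / del)) / 2) * cos (t * y + a)).
Proof.
elim: n phi t a => [|n IHn] phi t a /=; first exact: goodZ.
(* Product formula: multiplying a cosine by [sin (y / del)] gives two cosines of shifted frequency and phase. *)
pose bc p s b y := binomial_mean n p ((1 + sin (y / del)) / 2) * cos (s * y + b).
pose D p y := 2^-1 * (bc p (del^-1 + t) (a - pi / 2) y + bc p (del^-1 - t) (- a - pi / 2) y).
have gD p : good (D p) by apply: goodZ; apply: goodD; exact: IHn.
have DE p y : D p y = binomial_mean n p ((1 + sin (y / del)) / 2) * (sin (y / del) * cos (t * y + a)).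
  rewrite /D /bc.
  rewrite (_ : (del^-1 + t) * y + (a - pi / 2) = (y / del + (t * y + a)) - pi / 2); last by ring.
  rewrite (_ : (del^-1 - t) * y + (- a - pi / 2) = (y / del - (t * y + a)) - pi / 2); last by ring.
  by rewrite !cosBpihalf sinD sinB; field.
have := goodD (goodD (goodZ 2^-1 (IHn phi t a)) (goodZ (- 2^-1) (gD phi)))
  (goodD (goodZ 2^-1 (IHn (phi \o S) t a)) (goodZ 2^-1 (gD (phi \o S)))).
apply: good_eq => y; rewrite !DE.
by field.
Qed.

Hypothesis tight : tight_seq.

(** Tightness confines the problem to a bounded interval, where a Bernstein
    polynomial in the sine of a slow frequency approximates [h]; outside, both
    are bounded. *)
Lemma weak_cvg_continuous (h : R -> R) (M : R) : continuous h ->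
  (forall y, `|h y| <= M) -> weak_cvg h.
Proof.
move=> ch hM; apply: cvg_approx => e e0.
have M0 : 0 <= M by exact: le_trans (hM 0).
have mh : measurable_fun setT h by exact: continuous_measurable_fun.
pose e1 : R := e / (3 + 2 * M).
have e10 : 0 < e1 by rewrite divr_gt0// ltr_pwDl// mulr_ge0.
have [K1 HK1] := tight e10.
have [K2 HK2] := exceeds_small Q mY e10.
pose K : R := (K1 + K2).+1%:R.
have K0 : 0 < K by rewrite ltr0n.
have K1K : K1%:R <= K by rewrite ler_nat leqW// leq_addr.
have K2K : K2%:R <= K by rewrite ler_nat leqW// leq_addl.
have [w cw wK] := sine_window K0.
pose u y : R := (1 + sin (y / (2 * K))) / 2.
have u01 y : 0 <= u y <= 1.
  by have := sin_geN1 (y / (2 * K)); have := sin_le1 (y / (2 * K)); rewrite /u => h1 h2; apply/andP; split; lra.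
pose H := h \o w.
have cH : continuous H by move=> x; apply: continuous_comp; [exact: cw|exact: ch].
have HM v : `|H v| <= M by exact: hM.
have cid : continuous (id : R -> R) by move=> x; exact: cvg_id.
have [r r0 Hr] := @unif_near_curve R R id H cid cH 1 e1 e10.
(* Continuity at scale [r] turned into the quadratic modulus required by [bernstein_approx]. *)
pose C : R := 2 * M / r ^+ 2.
have C0 : 0 <= C by apply: divr_ge0; [exact: mulr_ge0|exact: sqr_ge0].
have HC v w' : 0 <= v <= 1 -> `|H v - H w'| <= e1 + C * (v - w') ^+ 2.
  move=> /andP[v0 v1]; have [vw|vw] := ltP `|v - w'| r.
    apply: (@le_trans _ _ e1); last by rewrite lerDl mulr_ge0// sqr_ge0.
    by apply: (Hr v) => //; rewrite ger0_norm.
  apply: (@le_trans _ _ (2 * M)).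
    by apply: (le_trans (ler_normB _ _)); rewrite mulrDl !mul1r lerD.
  apply: (@le_trans _ _ (C * (v - w') ^+ 2)); last by rewrite lerDr ltW.
  rewrite /C mulrAC ler_pdivlMr ?exprn_gt0// ler_wpM2l ?mulr_ge0//.
  by rewrite -(real_normK (num_real (v - w'))) lerXn2r ?nnegrE// ltW.
(* The degree, large enough for the variance term [C / N]. *)
pose N := (Num.truncn (C / e1)).+1.
have CN : C / N%:R <= e1.
  rewrite ler_pdivrMr ?ltr0n// mulrC -ler_pdivrMr//.
  exact: ltW (Num.Theory.truncnS_gt _).
pose B y := binomial_mean N (fun k => H (k%:R / N%:R)) (u y).
have BM y : `|B y| <= M by apply: binomial_mean_bounded.
have hB y : `|y| <= K -> `|h y - B y| <= 2 * e1.
  move=> yK; have -> : h y = H (u y) by rewrite /H /= wK.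
  apply: (le_trans (bernstein_approx (ltn0Sn _) (u01 y) C0 (fun w' => HC _ w' (u01 y)))).
  by rewrite mulrDl mul1r lerD2l.
have hBfar U (X : U -> R) x : `|h (X x) - B (X x)| <= 2 * e1 + 2 * M * \1_[set y | K < `|y|] (X x).
  apply: exceeds_split; first by rewrite mulr_ge0// ltW.
    exact: hB.
  by apply: (le_trans (ler_normB _ _)); rewrite mulrDl !mul1r lerD.
have [mB _ Bc] : good B.
  apply: good_eq (good_bernstein (2 * K) N (fun k => H (k%:R / N%:R)) 0 0) => y.
  by rewrite mul0r add0r cos0 mulr1.
have eE : 2 * e1 + 2 * M * e1 <= e.
  rewrite -mulrDl /e1 mulrCA ger_pMr// ler_pdivrMr ?mul1r; first by lra.
  by rewrite ltr_pwDl// mulr_ge0.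
exists (fun n => \int[P]_x (G x * B (xi n x))), (\int[P]_x G x * \int[Q]_y B (Y y)).
split => //.
  rewrite -mulrBr normrM; apply: le_trans eE.
  apply: (@le_trans _ _ (1 * \int[Q]_y (2 * e1 + 2 * M * exceeds Y K y))).
    apply: ler_pM => //; first exact: Rint_norm_le G1.
    apply: Rint_dist_le; [exact: (qY_int mh hM)|exact: (qY_int mB BM)| |].
      by apply: L1D; [exact: L1_cst|apply: L1Z; exact: exceeds_L1].
    by move=> y; exact: hBfar.
  rewrite mul1r RintegralD//; [|exact: L1_cst|by apply: L1Z; exact: exceeds_L1].
  rewrite Rint_cst lerD2l RintegralZl//; last exact: exceeds_L1.
  by rewrite ler_wpM2l ?mulr_ge0// HK2.
apply: nearW => n; apply: le_trans eE.
apply: (@le_trans _ _ (\int[P]_x (2 * e1 + 2 * M * exceeds (xi n) K x))).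
  apply: Rint_dist_le; [exact: (Gq_int n mh hM)|exact: (Gq_int n mB BM)| |].
    by apply: L1D; [exact: L1_cst|apply: L1Z; exact: exceeds_L1].
  by move=> x; rewrite -mulrBr normrM -[leRHS]mul1r ler_pM//; exact: hBfar.
rewrite RintegralD//; [|exact: L1_cst|by apply: L1Z; exact: exceeds_L1].
rewrite Rint_cst lerD2l RintegralZl//; last exact: exceeds_L1.
by rewrite ler_wpM2l ?mulr_ge0// HK1.
Qed.

(** [D n x] bounds the distance from [X n x] to the curve.  Where [xi n] is
    bounded and [D n] is small, uniform continuity along the curve applies; the
    rest has small probability, as [D n] tends to [0] in [L^1]. *)
Lemma slutsky (V : pseudoMetricType R) (L : R -> V) (X : nat -> T -> V) (D : nat -> T -> R)
    (g : V -> R) (M : R) :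
  continuous L -> continuous g -> (forall v, `|g v| <= M) ->
  (forall n, measurable_fun setT (fun x => g (X n x))) ->
  (forall n, P.-integrable setT (EFin \o D n)) -> (forall n x, 0 <= D n x) ->
  (fun n => \int[P]_x D n x) @ \oo --> (0 : R) ->
  (forall n x r, D n x < r -> ball (L (xi n x)) r (X n x)) ->
  (fun n => \int[P]_x (G x * g (X n x))) @ \oo -->
    (\int[P]_x G x) * \int[Q]_y g (L (Y y)).
Proof.
move=> cL cg gM mgX iD D0 Dcvg Dball; apply: cvg_approx => e e0.
have M0 : 0 <= M by exact: le_trans (gM (L 0)).
have cgL : continuous (g \o L) by move=> x; apply: continuous_comp; [exact: cL|exact: cg].
have gL1 := weak_cvg_continuous cgL (fun y => gM (L y)).
pose e1 : R := e / (2 + 2 * M).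
have e10 : 0 < e1 by rewrite divr_gt0// ltr_pwDl// mulr_ge0.
have [K HK] := tight e10.
have [r r0 Hr] := unif_near_curve cL cg K%:R e10.
have dom n x : `|g (X n x) - g (L (xi n x))| <= e1 + 2 * M * exceeds (xi n) K%:R x + 2 * M / r * D n x.
  have gg2 : `|g (X n x) - g (L (xi n x))| <= 2 * M.
    by apply: (le_trans (ler_normB _ _)); rewrite mulrDl !mul1r lerD.
  have [Dr|Dr] := ltP (D n x) r.
    apply: (@le_trans _ _ (e1 + 2 * M * exceeds (xi n) K%:R x)); last by rewrite lerDl mulr_ge0// divr_ge0 ?mulr_ge0// ltW.
    apply: exceeds_split gg2; first exact: ltW.
    by move=> xK; rewrite distrC; apply: (Hr (xi n x)) => //; exact: Dball.
  apply: (@le_trans _ _ (2 * M / r * D n x)).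
    by apply: (le_trans gg2); rewrite mulrAC ler_pdivlMr// ler_wpM2l// mulr_ge0.
  by rewrite lerDr addr_ge0 ?(ltW e10)// mulr_ge0 ?mulr_ge0// exceeds_ge0.
exists (fun n => \int[P]_x (G x * g (L (xi n x)))), (\int[P]_x G x * \int[Q]_y g (L (Y y))).
split; [exact: gL1|by rewrite subrr normr0 ltW|].
have e20 : 0 < e1 / (2 * M / r + 1).
  by rewrite divr_gt0// ltr_wpDl// divr_ge0 ?mulr_ge0// ltW.
move/cvgrPdist_le : Dcvg => /(_ _ e20) Dcvg.
near=> n.
have Dn : \int[P]_x D n x <= e1 / (2 * M / r + 1).
  by apply: le_trans (ler_norm _) _; rewrite -normrN -sub0r; near: n.
have i1 := L1_cst P e1.
have i2 : P.-integrable setT (EFin \o (fun x => 2 * M * exceeds (xi n) K%:R x)) by apply: L1Z; exact: exceeds_L1.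
have i3 : P.-integrable setT (EFin \o (fun x => 2 * M / r * D n x)) by exact: L1Z.
have i12 := L1D i1 i2.
apply: (@le_trans _ _ (\int[P]_x (e1 + 2 * M * exceeds (xi n) K%:R x + 2 * M / r * D n x))).
  apply: Rint_dist_le.
  - by apply: L1_mul_bounded Gint _ (fun x => gM (X n x)).
  - by apply: (Gq_int n (q := g \o L)) (fun y => gM (L y)); exact: continuous_measurable_fun.
  - exact: L1D.
  - by move=> x; rewrite -mulrBr normrM -[leRHS]mul1r ler_pM.
rewrite !RintegralD// Rint_cst RintegralZl//; last exact: exceeds_L1.
rewrite RintegralZl//.
apply: (@le_trans _ _ (e1 + 2 * M * e1 + e1)).
  rewrite lerD//; first by rewrite lerD2l ler_wpM2l ?mulr_ge0// HK.
  apply: (le_trans (ler_wpM2l _ Dn)); first by rewrite divr_ge0 ?mulr_ge0// ltW.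
  rewrite mulrCA ger_pMr// ler_pdivrMr ?mul1r ?lerDl//.
  by rewrite ltr_wpDl// divr_ge0 ?mulr_ge0// ltW.
rewrite (_ : _ + _ = (2 + 2 * M) * e1); last by ring.
by rewrite /e1 mulrC divfK// gt_eqF// ltr_pwDl// mulr_ge0.
Unshelve. all: by end_near. Qed.

End weak_convergence.

(** * Borel measurability of random elements *)

Section borel_random_elements.
Context d (T : measurableType d).

Lemma random_element_open (V : topologicalType) (X : T -> V) :
  (forall A : set V, open A -> measurable (X @^-1` A)) -> random_element X.
Proof.
move=> XA _ [B sB <-]; rewrite setTI.
have : <<s open >> `<=` [set B : set V | measurable (X @^-1` B)].
  apply: smallest_sub => //; split => /=.
  - by rewrite preimage_set0.
  - by move=> C mC; rewrite setTD preimage_setC; exact: measurableC.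
  - by move=> F mF; rewrite preimage_bigcup; exact: bigcup_measurable.
exact.
Qed.

Lemma continuous_preimage_borel (V W : topologicalType) (h : V -> W) : continuous h ->
  forall B, <<s open >> B -> <<s open >> (h @^-1` B).
Proof.
move=> /continuousP ch.
have := smallest_sigma_algebra (setT : set V) open => -[s0 sC sU].
apply: smallest_sub; last by move=> B oB; apply: sub_sigma_algebra; exact: ch.
split => /=.
- by rewrite preimage_set0.
- by move=> C mC; rewrite setTD preimage_setC -setTD; exact: sC.
- by move=> F mF; rewrite preimage_bigcup; exact: sU.
Qed.

Lemma borel_preimage_comp (V W : topologicalType) (h : V -> W) (X : T -> V) :
  continuous h -> borel_preimage (h \o X) `<=` borel_preimage X.
Proof.
move=> ch _ [B sB <-]; exists (h @^-1` B) => //.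
exact: continuous_preimage_borel.
Qed.

Context {R : realType}.

Lemma borel_measurable (B : set R) : <<s open >> B -> measurable B.
Proof.
by apply: smallest_sub; [exact: sigma_algebra_measurable|move=> A; exact: open_measurable].
Qed.

Lemma random_element_measurable (V : topologicalType) (X : T -> V) (g : V -> R) :
  random_element X -> continuous g -> measurable_fun setT (g \o X).
Proof.
move=> rX cg; apply: (measurability _ (RGenOpens.measurableE R)) => //.
move=> _ [_ [a [b ->]] <-]; rewrite setTI.
apply: rX; exists (g @^-1` `]a, b[%classic); last by rewrite setTI.
apply: (continuous_preimage_borel cg); apply: sub_sigma_algebra.
exact: itv_open.
Qed.

Lemma measurable_random_element (V : topologicalType) (X : T -> R) (h : R -> V) :
  measurable_fun setT X -> continuous h -> random_element (h \o X).
Proof.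
move=> mX ch; apply: random_element_open => A oA.
rewrite comp_preimage -[X in measurable X]setTI; apply: mX => //.
by apply: open_measurable; move/continuousP : ch; apply.
Qed.

(** Every open set is a countable union of boxes with rational centres and radii
    [1 / (k + 1)]. *)
Lemma random_vector (m : nat) (X : T -> 'cV[R]_m) :
  (forall i, measurable_fun setT (fun x => X x i 0)) -> random_element X.
Proof.
move=> mX; apply: random_element_open => A oA.
pose rho (k : nat) : R := k.+1%:R^-1.
have rho0 k : 0 < rho k by rewrite invr_gt0.
pose box (qk : 'cV[rat]_m * nat) : set 'cV[R]_m := 
    @ball R _ (map_mx (@ratr R) qk.1 : 'cV[R]_m) (rho qk.2).
have AE : A = \bigcup_(qk in [set qk | box qk `<=` A]) box qk.
  apply/seteqP; split=> [v Av|v [qk /= qkA]]; last exact: qkA.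
  have [r /= r0 rA] : exists2 r : R, 0 < r & ball v r `<=` A.
    by move: oA; rewrite openE => /(_ v Av) /nbhs_ballP.
  pose k := Num.truncn (2 / r).
  have kr : rho k + rho k <= r.
    rewrite -mulr2n -mulr_natr ler_pdivrMl ?ltr0n// -ler_pdivrMr//.
    exact: ltW (Num.Theory.truncnS_gt _).
  have Hq (i : 'I_m) : exists q : rat, `|ratr q - v i 0| < rho k.
    have /rat_in_itvoo[q] : v i 0 - rho k < v i 0 + rho k by have := rho0 k; lra.
    by rewrite in_itv/= => /andP[h1 h2]; exists q; rewrite ltr_norml; apply/andP; split; lra.
  have [q hq] := @boolp.choice _ _ (fun i q => `|ratr q - v i 0| < rho k) Hq.
  pose Q : 'cV[rat]_m := \col_i q i.
  have Qv : box (Q, k) v by split => //= i j; rewrite !mxE ord1; exact: hq.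
  exists (Q, k) => //= w Qw; apply: rA.
  apply: (le_ball kr); apply: ball_triangle (ball_sym Qv) Qw.
rewrite AE preimage_bigcup.
rewrite bigcup_mkcond; apply: countable_bigcupT_measurable; first exact: countableP.
move=> [q k]; case: ifP => // _.
rewrite (_ : X @^-1` _ = \bigcap_(i in [set: 'I_m]) [set x | `|ratr (q i 0) - X x i 0| < rho k]).
  apply: fin_bigcap_measurable; first exact: finite_finset.
  move=> i _; rewrite (_ : [set x | _] = (fun x => X x i 0) @^-1` ball (ratr (q i 0) : R) (rho k)) //.
  by rewrite -[X in measurable X]setTI; apply: mX => //; exact: measurable_ball.
apply/seteqP; split => [x [_ h] i _|x h] /=; first by have := h i 0; rewrite mxE.
by split => //= i j; rewrite mxE ord1; exact: h.
Qed.

End borel_random_elements.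

Lemma mixing_cvg_comp (dT dT' : measure_display) (T : measurableType dT)
  (T' : measurableType dT') (R : realType) (P : probability T R) (P' : probability T' R)
  (proj : {RV P' >-> T}) (G : set (set T)) (V W : topologicalType) (h : V -> W)
  (X_ : nat -> T -> V) (X : T' -> V) :
  continuous h -> mixing_cvg P proj G X_ X ->
  mixing_cvg P proj G (fun n => h \o X_ n) (h \o X).
Proof.
move=> ch [rX_ rX ind lim]; split.
- by move=> n; apply: subset_trans (rX_ n); exact: borel_preimage_comp.
- by apply: subset_trans rX; exact: borel_preimage_comp.
- by move=> A B GA XB; apply: ind => //; exact: (borel_preimage_comp ch).
- move=> f g fi fG cg [M gM]; apply: (lim f (g \o h)) => //.
    by move=> x; apply: continuous_comp; [exact: ch|exact: cg].
  by exists M => x; exact: gM.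
Qed.

(** * The mixing central limit theorem *)

Section mixing_clt.
Context (R : realType) (dT : measure_display) (T : measurableType dT) (P : probability T R).
Variables (Z : nat -> {RV P >-> R}) (sigma : R).
Hypothesis Ziid : iid [set j | (0 < j)%N] Z.
Local Notation L1 f := (P.-integrable setT (EFin \o f)).
Hypothesis Zsq : L1 (fun x => Z 1%N x ^+ 2).
Hypothesis Zmean : \int[P]_x Z 1%N x = 0.
Hypothesis Zvar : \int[P]_x (Z 1%N x ^+ 2) = sigma ^+ 2.

(** A pi-system that generates the sigma-algebra of the innovations; its members
    depend on finitely many innovations. *)
Definition cylinders : set (set T) :=
  [set B | exists m A, (forall j, measurable (A j)) /\ B = cylinder Z m.+1 A].

Lemma cylinders_setT : cylinders setT.
Proof.
exists 0%N, (fun=> setT); split => //; by apply/esym/seteqP; split.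
Qed.

Lemma cylinders_setI : setI_closed cylinders.
Proof.
move=> _ _ [m [A [mA ->]]] [n [B [mB ->]]].
pose C j := (if (j < m.+1)%N then A j else setT) `&` (if (j < n.+1)%N then B j else setT).
exists (maxn m n), C; split=> [j|].
  by apply: measurableI; case: ifP.
apply/seteqP; split => x.
  move=> [xA xB] j /= /andP[j0 jmn]; split; case: ifPn => // h.
    by apply: xA; rewrite /= j0.
  by apply: xB; rewrite /= j0.
move=> xC; split => j /= /andP[j0 h].
  have [|] := xC j; first by rewrite /= j0 ltnS leq_max -(ltnS j m) h.
  by rewrite h.
have [|_] := xC j; first by rewrite /= j0 ltnS leq_max -(ltnS j n) h orbT.
by rewrite h.
Qed.

Lemma cylinders_measurable : cylinders `<=` measurable.
Proof. by move=> _ [m [A [mA ->]]]; exact: cylinder_measurable. Qed.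

Lemma sigma_family_cylinders : sigma_family [set j | (0 < j)%N] Z `<=` <<s cylinders >>.
Proof.
apply: smallest_sub; first exact: smallest_sigma_algebra.
move=> B [i /= i0 [A mA <-]]; rewrite setTI; apply: sub_sigma_algebra.
exists i, (fun j => if j == i then A else setT); split=> [j|].
  by case: ifP.
apply/seteqP; split => x.
  by move=> xA j /= _; case: eqP => [->|].
by move=> /(_ i); rewrite /= i0 ltnSn eqxx; apply.
Qed.

(** The indicator is a product of functions of the single innovations. *)
Lemma cylinder_indep m A : (forall j, measurable (A j)) -> indep_from Z m.+1 (\1_(cylinder Z m.+1 A)).
Proof.
move=> mA; have -> : \1_(cylinder Z m.+1 A) = fun x => \prod_(1 <= j < m.+1) \1_(A j) (Z j x) :> R.
  by apply/funext => x; rewrite prod_indic_cylinder.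
elim: m => [|m IHm].
  by under eq_fun do rewrite big_geq//; exact: indep_from1 Ziid.1.
have mi : measurable_fun setT (\1_(A m.+1) : R -> R) by exact: measurable_indic.
have [H _] := indep_from_mul (prod_indic_measurable Z _ mA) (prod_indic_bounded Z _ A) IHm
  mi (indic_norm_le1 R _).
rewrite (_ : (fun x => _) = (fun x => \prod_(1 <= j < m.+1) \1_(A j) (Z j x) * \1_(A m.+1) (Z m.+1 x)))//.
by apply/funext => x; rewrite big_nat_recr.
Qed.

Lemma normalized_tight :
  tight_seq P (fun n x => (Num.sqrt n%:R)^-1 * block_sum Z 1 n.+1 x).
Proof.
move=> e e0; exists (Num.truncn (sigma ^+ 2 / e)).+1 => K KK n.
have K1 : 1 <= K by apply: le_trans KK; rewrite ler1n.
have K0 : 0 < K by exact: lt_le_trans K1.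
have [bi bE] := block_sum_sqr Ziid Zsq Zmean Zvar n.+1 (ltn0Sn 0).
have sqE : (fun x => ((Num.sqrt n%:R)^-1 * block_sum Z 1 n.+1 x) ^+ 2) =
    (fun x => (Num.sqrt n%:R)^-1 ^+ 2 * block_sum Z 1 n.+1 x ^+ 2).
  by apply/funext => x; rewrite exprMn.
apply: (@le_trans _ _ (sigma ^+ 2 / K ^+ 2)).
  apply: exceeds_chebyshev => //.
  - by apply: measurable_funM => //; exact: measurable_block_sum.
  - by rewrite sqE; exact: L1Z.
  rewrite sqE RintegralZl// bE subn1/= exprVn sqr_sqrtr//.
  have [->|n0] := posnP n; first by rewrite invr0 mul0r sqr_ge0.
  by rewrite mulrA mulVf ?mul1r// pnatr_eq0 -lt0n.
rewrite ler_pdivrMr ?exprn_gt0// mulrC -ler_pdivrMr//.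
apply: (le_trans (ltW (Num.Theory.truncnS_gt _))); apply: (le_trans KK).
by rewrite expr2 ler_peMl// ltW.
Qed.

Context (dT' : measure_display) (T' : measurableType dT') (P' : probability T' R).
Variables (proj : {RV P' >-> T}) (N1 : {RV P' >-> R}).
Hypothesis N1law : forall A : set R, measurable A -> distribution P' N1 A = normal_prob 0 1 A.
Hypothesis N1indep : independent_of_base proj (sigma_family [set j | (0 < j)%N] Z)
    (g_sigma_algebra_preimage N1).

(** The sign is immaterial, as the characteristic function of the normal law is
    even in [t]; it is chosen because the limit of the theorem has the factor
    [(s - 1)^-1], while [(1 - s)^-1] multiplies the sum of the innovations. *)
Lemma gaussian_trig (t a : R) :
  \int[P']_w cos (t * (- sigma * N1 w) + a) =
    cos a * expR (- (t ^+ 2 * sigma ^+ 2 / 2)).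
Proof.
have mc : measurable_fun setT (fun y : R => cos (- (t * sigma) * y + a)).
  by apply: (measurable_cosZ _ a (X := id)).
have := normal_char a (- (t * sigma)); rewrite sqrrN exprMn => <-.
(* The same random variable, with values in the copy of the reals that carries the Lebesgue measure. *)
pose N1' : T' -> measurableTypeR R := N1.
have mN1' : measurable_fun setT N1'.
  by move=> _ A mA; apply: (@measurable_funPT _ _ _ _ N1 measurableT A mA).
pose N : {RV P' >-> measurableTypeR R} := HB.pack N1' (isMeasurableFun.Build _ _ _ _ N1' mN1').
rewrite /Rintegral; congr fine.
pose h (y : measurableTypeR R) := (cos (- (t * sigma) * y + a))%:E.
have mh : measurable_fun [set: measurableTypeR R] h by exact/measurable_EFinP.
transitivity (\int[distribution P' N]_y h y)%E.
  rewrite integral_distribution//; last first.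
    apply: (@bounded_L1 _ _ _ _ (fun w => cos (- (t * sigma) * N1 w + a)) 1).
      exact: measurable_cosZ.
    by move=> w; exact: cos_max.
  by apply: eq_integral => w _ /=; congr (cos _)%:E; rewrite /N /= /N1'; ring.
by apply: eq_measure_integral => A mA _; exact: N1law.
Qed.

(** Integrable weights are reduced to events, and these to cylinders, for which
    [mixing_clt_trig] and then [slutsky] apply.  In the application the curve
    [L] is the line spanned by a constant vector. *)
Theorem mixing_clt_transfer (V : pseudoMetricType R) (L : R -> V)
    (X : nat -> T -> V) (D : nat -> T -> R) :
  continuous L -> (forall n, random_element (X n)) ->
  (forall n, L1 (D n)) -> (forall n x, 0 <= D n x) ->
  (fun n => \int[P]_x D n x) @ \oo --> (0 : R) ->
  (forall n x r, D n x < r -> ball (L ((Num.sqrt n%:R)^-1 * block_sum Z 1 n.+1 x)) r (X n x)) ->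
  mixing_cvg P proj (sigma_family [set j | (0 < j)%N] Z) X (fun w => L (- sigma * N1 w)).
Proof.
move=> cL rX iD D0 Dcvg Dball.
have mY : measurable_fun setT (fun w => - sigma * N1 w) by exact: measurable_funM.
have cL' : continuous (fun y : R => L (- sigma * y)).
  move=> y; apply: (@continuous_comp _ _ _ (fun y : R => - sigma * y) L); last exact: cL.
  by apply: cvgM; [exact: cvg_cst|exact: cvg_id].
have rXN : random_element (fun w => L (- sigma * N1 w)).
  exact: (measurable_random_element (@measurable_funPT _ _ _ _ N1) cL').
split => //.
  move=> A B GA [C oC <-]; apply: N1indep => //.
  exists ((fun y : R => L (- sigma * y)) @^-1` C) => //.
  by apply: borel_measurable; apply: continuous_preimage_borel cL' _ oC.
move=> f g fi fG cg [M gM].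
have mgX n : measurable_fun setT (fun x => g (X n x)) by exact: random_element_measurable (rX n) cg.
have ifg n : L1 (fun x => f x * g (X n x)) by exact: L1_mul_bounded fi (mgX n) (fun x => gM (X n x)).
have igL : P'.-integrable setT (EFin \o (fun w => g (L (- sigma * N1 w)))).
  apply: bounded_L1 (fun w => gM _); exact: (random_element_measurable rXN cg).
under eq_fun do rewrite (expectationE (ifg _)).
rewrite (expectationE fi) (expectationE igL) -EFinM; apply: cvg_EFin; first exact: nearW.
have cylT : <<s cylinders >> `<=` (measurable : set (set T)).
  apply: smallest_sub; [exact: sigma_algebra_measurable|exact: cylinders_measurable].
have mixcyl B : cylinders B -> mixes P (fun n x => g (X n x)) (\int[P']_w g (L (- sigma * N1 w))) (\1_B).
  move=> [m [A [mA ->]]].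
  apply: (slutsky (Y := fun w => - sigma * N1 w) _ _ _ _ _ _ cL cg gM mgX iD D0 Dcvg Dball) => //.
  - by move=> n; apply: measurable_funM => //; exact: measurable_block_sum.
  - by apply: measurable_indic; exact: cylinder_measurable.
  - by move=> x; exact: indic_norm_le1.
  - move=> t a; rewrite /weak_cvg gaussian_trig.
    apply: (mixing_clt_trig Ziid Zsq Zmean Zvar (ltn0Sn m)).
    + by apply: measurable_indic; exact: cylinder_measurable.
    + by move=> x; exact: indic_norm_le1.
    + exact: cylinder_indep.
  - exact: normalized_tight.
have mixT := mixcyl _ cylinders_setT.
apply: (mixes_measurable mgX (fun n x => gM (X n x)) (G := <<s cylinders >>)) => //.
  apply: (mixes_sigma mgX (fun n x => gM (X n x))) => //.
  - exact: cylinders_setI.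
  - exact: cylinders_measurable.
by apply: (subset_trans fG); exact: sigma_family_cylinders.
Qed.

End mixing_clt.

(** * Powers of the inverse companion matrix *)

Section power_summability.
Variables (C : numClosedFieldType) (d : nat).
Implicit Types (A V : 'M[C]_d.+1).

(** If [S] is a partial sum of the norms of [a], the recursion gives [S <= |a_0|
    + |lam| S + K]. *)
Lemma peel_eigenvalue (lam : C) (a b : nat -> C) (K : C) : `|lam| < 1 ->
  (forall k, a k.+1 = lam * a k + b k) ->
  (forall n, \sum_(k < n) `|b k| <= K) ->
  forall n, \sum_(k < n) `|a k| <= (`|a 0%N| + K) / (1 - `|lam|).
Proof.
move=> lam1 rec bK n.
have l0 : 0 < 1 - `|lam| by rewrite subr_gt0.
rewrite ler_pdivlMr// mulrBr mulr1 lerBlDr.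
apply: (@le_trans _ _ (\sum_(k < n.+1) `|a k|)).
  by rewrite big_ord_recr/= lerDl.
rewrite big_ord_recl/= -addrA lerD2l.
apply: (@le_trans _ _ (\sum_(k < n) (`|b k| + `|a k| * `|lam|))).
  apply: ler_sum => k _; rewrite /bump/= add1n rec addrC.
  by rewrite (le_trans (ler_normD _ _))// normrM mulrC.
by rewrite big_split/= -mulr_suml lerD2r bK.
Qed.

(** Induction on the number of linear factors of an annihilating polynomial.
    With [V' = (A - z) V], the entries of [A ^ k V] satisfy a first order
    recursion of ratio [z] driven by the entries of [A ^ k V'], and [V'] is
    annihilated by one factor fewer. *)
Lemma summable_powers_annihilated A (s : seq C) : all (fun z => `|z| < 1) s ->
  forall V, horner_mx A (\prod_(z <- s) ('X - z%:P)) *m V = 0 ->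
  forall i j, exists K : C, forall n, \sum_(k < n) `|(A ^+ k *m V) i j| <= K.
Proof.
elim: s => [|z s IHs] /=.
  move=> _ V; rewrite big_nil rmorph1 mul1mx => -> i j; exists 0 => n.
  by rewrite big1// => k _; rewrite mulmx0 mxE normr0.
move=> /andP[z1 sall] V; rewrite big_cons mulrC rmorphM/= => H i j.
pose V' := (A - z%:M) *m V.
have [|K HK] := IHs sall V' _ i j.
  by rewrite -H /V' mulmxA; congr (_ *m _ *m _); rewrite rmorphB/= horner_mx_X horner_mx_C.
exists ((`|(A ^+ 0 *m V) i j| + K) / (1 - `|z|)) => n.
apply: (peel_eigenvalue (a := fun k => (A ^+ k *m V) i j) (b := fun k => (A ^+ k *m V') i j) z1 _ HK) => k.
rewrite /V' mulmxBl mulmxBr mulmxA -[A ^+ k *m A]/(A ^+ k * A) -exprSr.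
rewrite mul_scalar_mx -scalemxAr !mxE; ring.
Qed.

(** By Cayley-Hamilton the characteristic polynomial, which splits, annihilates
    the identity matrix. *)
Lemma summable_powers A : (forall z, eigenvalue A z -> `|z| < 1) ->
  forall i j, exists K : C, forall n, \sum_(k < n) `|(A ^+ k) i j| <= K.
Proof.
move=> evA i j.
have [s sE] := closed_field_poly_normal (char_poly A).
rewrite (monicP (char_poly_monic A)) scale1r in sE.
have sall : all (fun z => `|z| < 1) s.
  apply/allP => z zs; apply: evA; rewrite eigenvalue_root_char sE root_prod_XsubC//.
have [|K HK] := @summable_powers_annihilated A s sall 1%:M _ i j.
  by rewrite -sE Cayley_Hamilton mul0mx.
by exists K => n; under eq_bigr do rewrite -[A ^+ _]mulmx1.
Qed.

End power_summability.

Section companion.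
Variables (R : realType) (d : nat) (theta : 'cV[R]_d.+1).
Hypothesis htheta : Theta_pe theta.
Local Notation B := (companion theta).
Local Notation Bc := (map_mx (real_complex R) B).

Lemma companion_unit : B \in unitmx.
Proof.
rewrite -(map_unitmx (real_complex R)) -row_free_unit.
have : ~ eigenvalue Bc 0 by move=> /htheta; rewrite normr0 ltr10.
by rewrite /eigenvalue /eigenspace kermx_eq0 raddf0 subr0 => /negP; rewrite negbK.
Qed.

Lemma sum_theta_neq1 : \sum_i theta i 0 != 1.
Proof.
apply/eqP => s1.
have : ~ eigenvalue Bc 1 by move=> /htheta; rewrite normr1 ltxx.
rewrite /eigenvalue /eigenspace kermx_eq0 => /negP; rewrite negbK row_free_unit => U.
have : (Bc - 1%:M) *m (const_mx 1 : 'cV_d.+1) = 0.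
  have -> : const_mx 1 = map_mx (real_complex R) (const_mx 1) :> 'cV_d.+1.
    by apply/matrixP => i j; rewrite !mxE rmorph1.
  rewrite mulmxBl mul1mx -map_mxM.
  rewrite (_ : B *m _ = const_mx 1) ?subrr//.
  apply/matrixP => i j; rewrite !mxE.
  have [i0|i0] := eqVneq (i : nat) 0%N.
    by rewrite -[RHS]s1; apply: eq_bigr => k _; rewrite !mxE i0 eqxx mulr1.
  have i1 : (i.-1 < d.+1)%N by rewrite (leq_ltn_trans (leq_pred i)).
  rewrite (bigD1 (Ordinal i1))//= !mxE (negbTE i0) /= prednK ?lt0n// eqxx mulr1.
  rewrite big1 ?addr0// => k kne; rewrite !mxE (negbTE i0) mulr1.
  case: eqP => // ik; case/negP: kne; apply/eqP/val_inj => /=.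
  by rewrite ik.
move=> /(congr1 (mulmx (invmx (Bc - 1%:M)))); rewrite mulKmx// mulmx0.
by move=> /matrixP/(_ 0 0); rewrite !mxE => /eqP; rewrite oner_eq0.
Qed.

(** The eigenvalues of the inverse matrix are the inverses of those of the
    companion matrix, hence of norm less than [1]. *)
Lemma companion_inv_summable i j :
  exists K : R, forall n, \sum_(k < n) `|(invmx B ^+ k) i j| <= K.
Proof.
pose Ac := map_mx (real_complex R) (invmx B).
have Bu := companion_unit.
have AB : Ac *m Bc = 1%:M by rewrite -map_mxM mulVmx// map_mx1.
have [|K HK] := @summable_powers _ _ Ac _ i j.
  move=> z /eigenvalueP[v vA v0].
  have vz : v = z *: (v *m Bc) by rewrite scalemxAl -vA -mulmxA AB mulmx1.
  have z0 : z != 0 by apply/eqP => z0; move: v0; rewrite vz z0 scale0r eqxx.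
  have : eigenvalue Bc z^-1.
    by apply/eigenvalueP; exists v => //; rewrite {2}vz scalerA mulVf// scale1r.
  by move=> /htheta; rewrite normfV invf_gt1 ?normr_gt0.
exists (complex.Re K) => n.
have := HK n.
have -> : \sum_(k < n) `|(Ac ^+ k) i j| = real_complex R (\sum_(k < n) `|(invmx B ^+ k) i j|).
  rewrite rmorph_sum; apply: eq_bigr => k _.
  by rewrite /Ac -rmorphXn/= mxE normc_def/= expr0n/= addr0 sqrtr_sqr.
by rewrite lecE/= => /andP[].
Qed.

End companion.

(** * The stationary solution is bounded in mean *)

(** Fatou's lemma for almost sure limits of sequences bounded in [L^1]. *)
Lemma fatou_norm d (T : measurableType d) (R : realType) (P : probability T R)
    (f_ : nat -> T -> R) (f : T -> R) (C : R) :
  (forall m, P.-integrable setT (EFin \o f_ m)) -> measurable_fun setT f ->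
  {ae P, forall x, f_ ^~ x @ \oo --> f x} ->
  (forall m, \int[P]_x `|f_ m x| <= C) ->
  P.-integrable setT (EFin \o f) /\ \int[P]_x `|f x| <= C.
Proof.
move=> fi mf ff fC.
have mfa m : measurable_fun setT (fun x => (`|f_ m x|)%:E).
  by apply/measurable_EFinP; apply: measurableT_comp => //; exact: L1_measurable (fi m).
have mf' : measurable_fun setT (fun x => (`|f x|)%:E).
  by apply/measurable_EFinP; exact: measurableT_comp.
have fC' m : (\int[P]_x (`|f_ m x|)%:E <= C%:E)%E.
  rewrite -[leLHS]fineK ?lee_fin; first exact: fC.
  exact: integrable_fin_num (L1_norm (fi m)).
have key : (\int[P]_x (`|f x|)%:E <= C%:E)%E.
  have -> : (\int[P]_x (`|f x|)%:E = \int[P]_x limn_einf (fun m => (`|f_ m x|)%:E))%E.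
    apply: ae_eq_integral => //.
      apply: (measurableT_comp (f := -%E)) => //.
      by apply: measurable_fun_limn_esup => m; exact: measurableT_comp.
    apply: filterS ff => x fx _; apply/esym.
    apply: (cvg_limn_einf_sup _).1; apply: cvg_EFin; first exact: nearW.
    exact: cvg_norm.
  apply: (le_trans (fatou P measurableT mfa _)).
    by move=> m x _; rewrite lee_fin.
  rewrite limn_einf_lim; apply: lime_le; first exact: is_cvg_einfs.
  apply: nearW => n; apply: (le_trans _ (fC' n)).
  by apply: ereal_inf_lbound; exists n => /=.
have fint : P.-integrable setT (EFin \o f).
  apply/integrableP; split; first exact/measurable_EFinP.
  by apply: le_lt_trans key _; rewrite ltry.
split=> //; rewrite -lee_fin /Rintegral fineK//.
exact: integrable_fin_num (L1_norm fint).
Qed.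

Lemma cvg_sum_seq (R : realType) (I : Type) (s : seq I) (u : I -> nat -> R) (l : I -> R) :
  (forall i, u i @ \oo --> l i) ->
  (fun n => \sum_(i <- s) u i n) @ \oo --> \sum_(i <- s) l i.
Proof.
move=> ul; elim: s => [|i s IHs].
  by under eq_fun do rewrite big_nil; rewrite big_nil; exact: cvg_cst.
under eq_fun do rewrite big_cons.
by rewrite big_cons; apply: cvgD.
Qed.

Section stationary_solution.
Context d (T : measurableType d) (R : realType) (P : probability T R).
Variables (p : nat) (theta : 'cV[R]_p.+1) (Z : nat -> {RV P >-> R}) (Y : int -> {RV P >-> R}).
Hypothesis htheta : Theta_pe theta.
Hypothesis Yrec : forall n : nat, (0 < n)%N ->
    {ae P, forall w, Y n%:Z w =
      \sum_(i < p.+1) theta i 0 * Y (n%:Z - i.+1%:Z) w + Z n w}.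
Hypothesis Yinit : {ae P, forall w,
    (fun n : nat => - \sum_(1 <= j < n.+1)
        (invmx (companion theta) ^+ j *m e1_scaled p.+1 (Z j w))) @ \oo -->
      lag_vector p.+1 Y 0 w}.
Local Notation B := (companion theta).
Local Notation A := (invmx (companion theta)).
Local Notation L1 f := (P.-integrable setT (EFin \o f)).

Lemma ae_rec : {ae P, forall w, forall n : nat, Y n.+1%:Z w =
      \sum_(i < p.+1) theta i 0 * Y (n.+1%:Z - i.+1%:Z) w + Z n.+1 w}.
Proof. by apply/ae_foralln => n; exact: Yrec. Qed.

Lemma mul_e1_scaled (M : 'M[R]_p.+1) z i : (M *m e1_scaled p.+1 z) i 0 = M i 0 * z.
Proof.
rewrite mxE (bigD1 ord0)//= mxE/= big1 ?addr0// => k k0.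
by rewrite mxE ifN ?mulr0.
Qed.

Lemma state_rec (w : T) (n : nat) (i : 'I_p.+1) :
  Y n.+1%:Z w = \sum_(i < p.+1) theta i 0 * Y (n.+1%:Z - i.+1%:Z) w + Z n.+1 w ->
  Y (n.+1%:Z - i%:Z) w = \sum_j B i j * Y (n%:Z - j%:Z) w + (if i == 0%N :> nat then Z n.+1 w else 0).
Proof.
move=> rec; have [i0|i0] := eqVneq (i : nat) 0%N.
  rewrite i0 subr0 rec; congr (_ + _); apply: eq_bigr => j _.
  by rewrite mxE i0 eqxx; congr (_ * Y _ w); lia.
have i1 : (i.-1 < p.+1)%N by rewrite (leq_ltn_trans (leq_pred i)).
rewrite (bigD1 (Ordinal i1))//= !mxE (negbTE i0) /= prednK ?lt0n// eqxx mul1r.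
rewrite big1 ?addr0 => [|k kne].
  by congr (Y _ w); move: i0; lia.
rewrite mxE (negbTE i0); case: eqP => [ik|_]; last by rewrite mul0r.
by case/negP: kne; apply/eqP/val_inj; rewrite /= ik.
Qed.

(** The coordinate [i] of [- sum_(n < j <= m) B ^ (n - j) W_j], a partial sum of
    the series for [U_n]. *)
Definition tail_sum (n : nat) (i : 'I_p.+1) (m : nat) (w : T) : R :=
  - \sum_(n.+1 <= j < m.+1) (A ^+ (j - n)) i 0 * Z j w.

(** Induction on [n], from the initial condition: multiplying the series for
    [U_n] by [B] and adding [W_(n + 1)] cancels its first term. *)
Lemma state_tail : {ae P, forall w, forall (n : nat) (i : 'I_p.+1),
  tail_sum n i ^~ w @ \oo --> Y (n%:Z - i%:Z) w}.
Proof.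
apply: filterS2 ae_rec Yinit => w rec init; elim=> [|n IHn] i.
  have <- : (fun m : nat => (- \sum_(1 <= j < m.+1) (A ^+ j *m e1_scaled p.+1 (Z j w))) i 0) =
      tail_sum 0 i ^~ w.
    apply/funext => m; rewrite /tail_sum mxE summxE; congr (- _); apply: eq_bigr => j _.
    by rewrite mul_e1_scaled subn0.
  have -> : Y (0%:Z - i%:Z) w = (lag_vector p.+1 Y 0 w) i 0 by rewrite mxE.
  by apply: (cvg_comp _ (fun M : 'cV[R]_p.+1 => M i 0) init); exact: coord_continuous.
rewrite (state_rec i (rec n)).
have : (fun m => \sum_j B i j * tail_sum n j m w + (if i == 0%N :> nat then Z n.+1 w else 0)) @ \oo -->
   \sum_j B i j * Y (n%:Z - j%:Z) w + (if i == 0%N :> nat then Z n.+1 w else 0).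
  apply: cvgD; last exact: cvg_cst.
  apply: cvg_sum_seq => j; apply: cvgM; [exact: cvg_cst|exact: IHn].
apply: cvg_trans; apply: near_eq_cvg; near=> m.
have nm : (n < m)%N by near: m; exists n.+1.
have BA k : B *m A ^+ k.+1 = A ^+ k by rewrite exprS mulmxA mulmxV ?mul1mx// companion_unit.
have -> : \sum_j B i j * tail_sum n j m w =
    - \sum_(n.+1 <= j < m.+1) (A ^+ (j - n).-1) i 0 * Z j w.
  rewrite /tail_sum; under eq_bigr do rewrite mulrN mulr_sumr.
  rewrite sumrN exchange_big/=; congr (- _); apply: eq_big_nat => j /andP[nj _].
  rewrite -(BA (j - n).-1) prednK ?subn_gt0//.
  by rewrite mxE mulr_suml; apply: eq_bigr => k _; rewrite mulrA.
rewrite big_ltn// subSn// subnn expr0 /tail_sum opprD addrAC.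
rewrite (_ : - (_ * Z n.+1 w) + _ = 0).
  rewrite add0r; congr (- _); apply: eq_big_nat => j /andP[nj _].
  by rewrite subnS.
by rewrite /= mxE -val_eqE/=; case: eqP => _; rewrite ?mul1r ?mul0r ?addNr// oppr0 addr0.
Unshelve. all: by end_near. Qed.

(** Fatou's lemma for the series of [state_tail]; the coefficients are summable
    uniformly in the starting index, as only the differences [j - n] matter. *)
Lemma state_L1_bounded (M : R) :
  (forall j, (0 < j)%N -> L1 (Z j) /\ \int[P]_x `|Z j x| <= M) ->
  exists2 C : R, 0 <= C & forall (n : nat) (i : 'I_p.+1),
    L1 (Y (n%:Z - i%:Z)) /\ \int[P]_x `|Y (n%:Z - i%:Z) x| <= C.
Proof.
move=> ZM.
have M0 : 0 <= M by apply: le_trans (ZM 1%N isT).2; exact: Rintegral_ge0.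
have [K HK] := @boolp.choice _ _ (fun i C => forall n, \sum_(k < n) `|(A ^+ k) i 0| <= C)
  (fun i => companion_inv_summable htheta i 0).
have K0 i : 0 <= K i by have := HK i 0%N; rewrite big_ord0.
exists (\sum_i K i * M); first by apply: sumr_ge0 => i _; rewrite mulr_ge0.
move=> n i.
have KC : K i * M <= \sum_i K i * M.
  by rewrite (bigD1 i)//= lerDl sumr_ge0// => k _; rewrite mulr_ge0.
pose F j (w : T) : R := if (0 < j)%N then (A ^+ (j - n)) i 0 * Z j w else 0.
have Fi j : L1 (F j).
  rewrite /F; case: ltnP => [j0|_]; last exact: L1_cst.
  by apply: L1Z; exact: (ZM j j0).1.
have tailE m : tail_sum n i m = fun w => -1 * \sum_(n.+1 <= j < m.+1) F j w.
  apply/funext => w; rewrite /tail_sum mulN1r; congr (- _); apply: eq_big_nat => j /andP[nj _].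
  by rewrite /F (leq_trans _ nj).
apply: (fatou_norm (f_ := tail_sum n i)).
- by move=> m; rewrite tailE; apply: L1Z; exact: L1_sum.
- by [].
- by apply: filterS state_tail => w; exact.
move=> m; apply: le_trans KC.
apply: (@le_trans _ _ (\int[P]_x (\sum_(n.+1 <= j < m.+1) `|F j x|))).
  apply: le_Rint; first by apply: L1_norm; rewrite tailE; apply: L1Z; exact: L1_sum.
    by apply: L1_sum => j; exact: L1_norm.
  by move=> w; rewrite tailE normrM normrN1 mul1r; exact: ler_norm_sum.
rewrite Rint_sum; last by move=> j; exact: L1_norm.
apply: (@le_trans _ _ (\sum_(n.+1 <= j < m.+1) `|(A ^+ (j - n)) i 0| * M)).
  rewrite big_nat [leRHS]big_nat; apply: ler_sum => j /andP[nj _].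
  have j0 : (0 < j)%N by exact: leq_trans nj.
  rewrite /F j0; under eq_Rintegral do rewrite normrM.
  rewrite RintegralZl//; last exact/L1_norm/(ZM j j0).1.
  by rewrite ler_wpM2l// (ZM j j0).2.
rewrite -mulr_suml ler_wpM2r//; apply: le_trans (HK i (m - n).+1).
have [mn|nm] := ltnP m n.
  by rewrite big_geq ?sumr_ge0// ltnS ltnW.
rewrite -[in leLHS](add1n n) big_addn subSn//.
rewrite -(big_mkord predT (fun k => `|(A ^+ k) i 0|)) [leRHS]big_ltn//.
by under [leLHS]eq_bigr do rewrite addnK; rewrite lerDr.
Qed.

End stationary_solution.

(** * Sums of the autoregressive process *)

Section lagged_sums.
Variables (R : realType) (p : nat) (theta : 'cV[R]_p.+1) (y : int -> R) (z : nat -> R).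

Definition lag_sum (i n : nat) : R := \sum_(1 <= k < n.+1) y (k%:Z - i%:Z).

Definition boundary (i n : nat) : R := \sum_(l < i) (y (0%:Z - l%:Z) - y (n%:Z - l%:Z)).

(** Consecutive lags differ by a telescoping sum. *)
Lemma lag_sumE i n : lag_sum i n = lag_sum 0 n + boundary i n.
Proof.
elim: i => [|i IHi]; first by rewrite /boundary big_ord0 addr0.
rewrite /boundary big_ord_recr/= addrA -/(boundary i n) -IHi /lag_sum.
elim: n {IHi} => [|n IHn]; first by rewrite !big_geq// subrr addr0.
rewrite big_nat_recr//= IHn [in RHS]big_nat_recr//=.
rewrite (_ : n.+1%:Z - i.+1%:Z = n%:Z - i%:Z); last by lia.
by ring.
Qed.

(** Sum the recursion over [k], then replace each lagged sum by the unlagged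
    one. *)
Lemma lag_sum_rec n :
  (forall n : nat, y n.+1%:Z = \sum_(i < p.+1) theta i 0 * y (n.+1%:Z - i.+1%:Z) + z n.+1) ->
  (1 - \sum_i theta i 0) * lag_sum 0 n =
    \sum_(j < p.+1) theta j 0 * boundary j.+1 n + \sum_(1 <= k < n.+1) z k.
Proof.
move=> rec.
have : lag_sum 0 n = \sum_(j < p.+1) theta j 0 * lag_sum j.+1 n + \sum_(1 <= k < n.+1) z k.
  under [in RHS]eq_bigr do rewrite /lag_sum mulr_sumr.
  rewrite exchange_big/= -big_split/=; apply: eq_big_nat => k /andP[k0 _].
  by rewrite subr0 -(prednK k0) rec.
under eq_bigr do rewrite lag_sumE mulrDr.
rewrite big_split/= -mulr_suml mulrBl mul1r => {1}->.
by ring.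
Qed.

End lagged_sums.

Theorem proposition2p4 (R : realType)
  (dT : measure_display) (T : measurableType dT) (P : probability T R)
  (d : nat) (hd : (0 < d)%N) (theta : 'cV[R]_d) (htheta : Theta_pe theta)
  (Z : nat -> {RV P >-> R}) (sigma : R)
  (Ziid : iid [set j | (0 < j)%N] Z)
  (ZL2 : (Z 1%N : T -> R) \in Lfun P 2%:E)
  (Zmean : ('E_P[Z 1%N] = 0)%E)
  (Zvar : ('V_P[Z 1%N] = (sigma ^+ 2)%:E)%E)
  (hsigma : 0 < sigma)
  (Y : int -> {RV P >-> R})
  (Yrec : forall n : nat, (0 < n)%N ->
    {ae P, forall w, Y n%:Z w =
      \sum_(i < d) theta i 0 * Y (n%:Z - i.+1%:Z) w + Z n w})
  (Yinit : {ae P, forall w,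
    (fun n : nat => - \sum_(1 <= j < n.+1)
        (invmx (companion theta) ^+ j *m e1_scaled d (Z j w))) @ \oo -->
      lag_vector d Y 0 w})
  (dT' : measure_display) (T' : measurableType dT') (P' : probability T' R)
  (proj : {RV P' >-> T}) (hproj : is_extension P proj)
  (N1 : {RV P' >-> R})
  (N1law : forall A : set R, measurable A ->
    distribution P' N1 A = normal_prob 0 1 A)
  (N1indep : independent_of_base proj (sigma_family [set j | (0 < j)%N] Z)
    (g_sigma_algebra_preimage N1)) :
  mixing_cvg P proj (sigma_family [set j | (0 < j)%N] Z)
    (fun n w => (Num.sqrt n%:R)^-1 *: \sum_(1 <= k < n.+1) lag_vector d Y k w)
    (fun w' => (sigma / (\sum_(i < d) theta i 0 - 1) * N1 w') *:
      const_mx 1 : 'cV[R]_d)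
  /\
  mixing_cvg P proj (sigma_family [set j | (0 < j)%N] Z)
    (fun n w => (Num.sqrt n%:R)^-1 * \sum_(1 <= k < n.+1) Y k%:Z w)
    (fun w' => sigma / (\sum_(i < d) theta i 0 - 1) * N1 w').
Proof.
move: d hd theta htheta Yrec Yinit => [//|p] _ theta htheta Yrec Yinit.
set s := \sum_(i < p.+1) theta i 0.
have s1 : 1 - s != 0 by rewrite subr_eq0 eq_sym; exact: sum_theta_neq1.
have s1' : s - 1 != 0 by rewrite subr_eq0; exact: sum_theta_neq1.
have Zsq := Lfun2_integrable_sqr ZL2.
have Z1mean : \int[P]_x Z 1%N x = 0 by move: Zmean; rewrite unlock /Rintegral => ->.
have Z1var : \int[P]_x (Z 1%N x ^+ 2) = sigma ^+ 2.
  move: Zvar; rewrite varianceE// Zmean expe2 mule0 sube0 unlock /Rintegral => E.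
  by rewrite (_ : (fun x => (Z 1%N x ^+ 2)%:E) = (fun x => ((Z 1%N ^+ 2 : T -> R) x)%:E)) ?E.
have Zmean0 := innovation_mean0 Ziid Zsq Z1mean.
pose M := \int[P]_x `|Z 1%N x|.
have ZM j : (0 < j)%N -> P.-integrable setT (EFin \o Z j) /\ \int[P]_x `|Z j x| <= M.
  move=> j0; have [ij _] := Zmean0 j j0; split=> //; rewrite /M.
  have [_ ->//] := identically_distributed_L1 Ziid (psi := fun y => `|y|) j0 (@normr_measurable R setT) (L1_norm (Zmean0 1%N isT).1).
have [C C0 YC] := state_L1_bounded htheta Yrec Yinit ZM.
have mY j : measurable_fun setT (Y j) by [].
pose X n w : 'cV[R]_p.+1 := (Num.sqrt n%:R)^-1 *: \sum_(1 <= k < n.+1) lag_vector p.+1 Y k w.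
pose xi n x := (Num.sqrt n%:R)^-1 * block_sum Z 1 n.+1 x.
have XE n w (i : 'I_p.+1) : X n w i 0 = (Num.sqrt n%:R)^-1 * lag_sum (Y ^~ w) i n.
  by rewrite mxE summxE; congr (_ * _); apply: eq_bigr => k _; rewrite mxE.
have mX n (i : 'I_p.+1) : measurable_fun setT (fun w => X n w i 0).
  under eq_fun do rewrite XE; apply: measurable_funM => //.
  by apply: measurable_sum => k; exact: mY.
pose L (t : R) : 'cV[R]_p.+1 := ((1 - s)^-1 * t) *: const_mx 1.
have LE t i j : L t i j = (1 - s)^-1 * t by rewrite !mxE mulr1.
(* The distance of the vector from the multiple of the constant vector that approximates it. *)
pose D n x := \sum_(i < p.+1) `|X n x i 0 - (1 - s)^-1 * xi n x|.
have cL : continuous L.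
  move=> t; apply/cvg_ballP => e e0.
  have : (1 - s)^-1 * t' @[t' --> t] --> (1 - s)^-1 * t.
    by apply: cvgM; [exact: cvg_cst|exact: cvg_id].
  by move=> /cvg_ballP/(_ _ e0); apply: filterS => t' h; split=> // i j; rewrite !LE.
have D0 n x : 0 <= D n x by apply: sumr_ge0.
have Dball n x r : D n x < r -> ball (L (xi n x)) r (X n x).
  move=> Dr; split=> [|i j]; first exact: le_lt_trans Dr.
  rewrite LE ord1 /ball/= distrC; apply: le_lt_trans Dr.
  by rewrite /D (bigD1 i)//= lerDl sumr_ge0.
have bint := block_sum_L1 Ziid Zsq Z1mean Z1var.
have lint n (i : 'I_p.+1) : P.-integrable setT (EFin \o (fun w => lag_sum (Y ^~ w) i n)).
  by apply: L1_sum => k; exact: (YC k i).1.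
have Dint n : P.-integrable setT (EFin \o D n).
  apply: L1_sum => i; apply: L1_norm; under eq_fun do rewrite XE.
  by apply: L1B; [exact/L1Z/lint|exact/L1Z/L1Z/bint].
have Yn_int n (l : nat) : (l < p.+1)%N ->
    P.-integrable setT (EFin \o Y (n%:Z - l%:Z)) /\ \int[P]_x `|Y (n%:Z - l%:Z) x| <= C.
  by move=> lp; exact: (YC n (Ordinal lp)).
pose bd i n w := boundary (Y ^~ w) i n.
have bd_int i n : (i <= p.+1)%N -> P.-integrable setT (EFin \o bd i n) /\
    \int[P]_x `|bd i n x| <= i%:R * (2 * C).
  move=> ip.
  have [i1 i2] : P.-integrable setT (EFin \o (fun w => \sum_(l < i) (`|Y (0%:Z - l%:Z) w| + `|Y (n%:Z - l%:Z) w|)))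
     /\ \int[P]_w (\sum_(l < i) (`|Y (0%:Z - l%:Z) w| + `|Y (n%:Z - l%:Z) w|)) <= i%:R * (2 * C).
    have il (l : 'I_i) m : P.-integrable setT (EFin \o (fun w => `|Y (m%:Z - l%:Z) w|)).
      by apply/L1_norm/(Yn_int m l _).1; exact: leq_trans ip.
    split; first by apply: L1_sum => l; apply: L1D; exact: il.
    rewrite Rint_sum; last by move=> l; apply: L1D; exact: il.
    apply: (@le_trans _ _ (\sum_(l < i) (2 * C))); last by rewrite sumr_const card_ord -[leLHS]mulr_natl.
    apply: ler_sum => l _; have lp : (l < p.+1)%N by exact: leq_trans ip.
    rewrite RintegralD//.
    by rewrite mulrDl !mul1r lerD// (Yn_int _ _ lp).2.
  have bi : P.-integrable setT (EFin \o bd i n).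
    apply: (dominated_L1 _ i1).
      by apply: measurable_sum => l; apply: measurable_funB; exact: mY.
    move=> w; apply: (le_trans (ler_norm_sum _ _ _)); apply: ler_sum => l _.
    exact: ler_normB.
  split=> //; apply: le_trans i2; apply: le_Rint => //; first exact: L1_norm.
  move=> w; apply: (le_trans (ler_norm_sum _ _ _)); apply: ler_sum => l _.
  exact: ler_normB.
(* A majorant of [D n] before normalisation, made of boundary terms only. *)
pose E n w := \sum_(i < p.+1) (`|bd i n w| + `|(1 - s)^-1| * \sum_(j < p.+1) `|theta j 0| * `|bd j.+1 n w|).
pose K := \sum_(i < p.+1) (i%:R * (2 * C) + `|(1 - s)^-1| * \sum_(j < p.+1) `|theta j 0| * (j.+1%:R * (2 * C))).
have ibd (j : 'I_p.+1) n : P.-integrable setT (EFin \o (fun w => `|bd j.+1 n w|)).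
  by apply/L1_norm/(bd_int j.+1 n _).1.
have ibd0 (j : 'I_p.+1) n : P.-integrable setT (EFin \o (fun w => `|bd j n w|)).
  by apply/L1_norm/(bd_int j n _).1; exact: ltnW.
have isum n : P.-integrable setT (EFin \o (fun w => \sum_(j < p.+1) `|theta j 0| * `|bd j.+1 n w|)).
  by apply: L1_sum => j; apply: L1Z.
have iterm n (i : 'I_p.+1) : P.-integrable setT (EFin \o (fun w => `|bd i n w| +
    `|(1 - s)^-1| * \sum_(j < p.+1) `|theta j 0| * `|bd j.+1 n w|)).
  by apply: L1D => //; exact: L1Z.
have Eint n : P.-integrable setT (EFin \o E n) by exact: L1_sum.
have EK n : \int[P]_w E n w <= K.
  rewrite Rint_sum//; apply: ler_sum => i _.
  rewrite RintegralD//; last exact: L1Z.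
  apply: lerD; first by apply: (bd_int i n _).2; exact: ltnW.
  rewrite RintegralZl// ler_wpM2l// Rint_sum; last by move=> j; exact: L1Z.
  by apply: ler_sum => j _; rewrite RintegralZl// ler_wpM2l// (bd_int j.+1 n _).2.
have DE n : {ae P, forall w, D n w <= (Num.sqrt n%:R)^-1 * E n w}.
  apply: filterS (ae_rec Yrec) => w rec.
  rewrite /D /E mulr_sumr; apply: ler_sum => i _.
  have S0 : lag_sum (Y ^~ w) 0 n = (1 - s)^-1 *
      (\sum_(j < p.+1) theta j 0 * bd j.+1 n w + block_sum Z 1 n.+1 w).
    by rewrite -(lag_sum_rec (z := fun k => Z k w) n rec) mulrA mulVf// mul1r.
  rewrite XE lag_sumE S0 /xi.
  set sb := \sum_(j < _) _; set sq := (Num.sqrt _)^-1; set r := (1 - s)^-1.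
  rewrite (_ : _ - _ = sq * (bd i n w + r * sb)); last by rewrite /bd; ring.
  rewrite normrM ger0_norm ?invr_ge0 ?sqrtr_ge0// ler_wpM2l ?invr_ge0 ?sqrtr_ge0//.
  apply: (le_trans (ler_normD _ _)); rewrite lerD2l normrM ler_wpM2l//.
  apply: (le_trans (ler_norm_sum _ _ _)); apply: ler_sum => j _.
  by rewrite normrM.
have Dcvg : (fun n => \int[P]_x D n x) @ \oo --> (0 : R).
  have Kc : (fun n => (Num.sqrt n%:R)^-1 * K) @ \oo --> (0 : R).
    by rewrite -[X in _ --> X](mul0r K); apply: cvgM; [exact: cvg_invsqrt|exact: cvg_cst].
  apply: (@squeeze_cvgr _ _ _ _ (cst 0) _ _ _ _ _ Kc); last exact: cvg_cst.
  apply: nearW => n; apply/andP; split; first exact: Rintegral_ge0.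
  have sq0 : 0 <= (Num.sqrt n%:R)^-1 :> R by rewrite invr_ge0 sqrtr_ge0.
  apply: le_trans (ler_wpM2l sq0 (EK n)).
  rewrite -RintegralZl//.
  have Ei : P.-integrable setT (EFin \o (fun w => (Num.sqrt n%:R)^-1 * E n w)) by exact: L1Z.
  rewrite /Rintegral fine_le//; [exact: integrable_fin_num (Dint n)|exact: integrable_fin_num Ei|].
  apply: ae_ge0_le_integral => //.
  - by move=> w _; rewrite lee_fin D0.
  - by apply/measurable_EFinP; exact: L1_measurable (Dint n).
  - move=> w _; rewrite lee_fin mulr_ge0//; apply: sumr_ge0 => i _.
    by rewrite addr_ge0// mulr_ge0// sumr_ge0// => j _; rewrite mulr_ge0.
  - by apply/measurable_EFinP; exact: L1_measurable Ei.
  - by apply: filterS (DE n) => w h _; rewrite lee_fin.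
have rX n : random_element (X n) by apply: random_vector => i; exact: mX.
have LN w : L (- sigma * N1 w) = (sigma / (s - 1) * N1 w) *: const_mx 1.
  rewrite /L; congr (_ *: _).
  rewrite (_ : (1 - s)^-1 = - (s - 1)^-1); last by rewrite -invrN opprB.
  by ring.
have part1 : mixing_cvg P proj (sigma_family [set j | (0 < j)%N] Z) X
    (fun w => (sigma / (s - 1) * N1 w) *: const_mx 1 : 'cV[R]_p.+1).
  rewrite -(funext LN).
  exact: (mixing_clt_transfer Ziid Zsq Z1mean Z1var N1law N1indep cL rX Dint D0 Dcvg Dball).
split; first exact: part1.
have cc : continuous (fun M : 'cV[R]_p.+1 => M ord0 ord0) by exact: coord_continuous.
have := mixing_cvg_comp cc part1.
rewrite (_ : (fun n => _) = (fun n w => (Num.sqrt n%:R)^-1 * \sum_(1 <= k < n.+1) Y k%:Z w)).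
  rewrite (_ : _ \o _ = (fun w' => sigma / (s - 1) * N1 w'))//.
  by apply/funext => w /=; rewrite !mxE mulr1.
apply/funext => n; apply/funext => w /=; rewrite XE; congr (_ * _).
by apply: eq_bigr => k _; rewrite subr0.
Qed.
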